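(* There exist two analytic functions $\phi_1,\phi_2\colon\mathbb D\to\mathbb D$ with $|\phi_1^*|=|\phi_2^*|$ $m$-a.e. on $\mathbb T$ such that $C_{\phi_2}\colon H^2\to H^2$ is compact while $C_{\phi_1}\colon H^2\to H^2$ is not compact.
   Context: $H^2$ is the classical Hardy space on the unit disc $\mathbb D$; $\phi^*$ denotes the radial boundary values of a bounded analytic $\phi$; $m$ is normalized Lebesgue measure on $\mathbb T$; $C_\phi f=f\circ\phi$. *)

(* Defs.v *)
From HB Require Import structures.
From mathcomp Require Import all_boot all_order all_algebra.
From mathcomp Require Import all_classical all_reals all_analysis.
From mathcomp Require Import complex.
Set Implicit Arguments. Unset Strict Implicit. Unset Printing Implicit Defensive.
Import Order.TTheory GRing.Theory Num.Theory.
Import numFieldNormedType.Exports.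
Local Open Scope classical_set_scope.
Local Open Scope ring_scope.

Section HardyDefs.
Variable R : realType.
Local Notation C := R[i].

Definition cabs (z : C) : R := Num.sqrt (complex.Re z ^+ 2 + complex.Im z ^+ 2).

Definition disc : set C := [set z | cabs z < 1].

Definition expi (t : R) : C := Complex (cos t) (sin t).

Definition taylor_on_disc (f : C -> C) (a : nat -> C) : Prop :=
  forall z, z \in disc ->
    (fun N : nat => cabs (\sum_(n < N) a n * z ^+ n - f z)) @ \oo --> (0 : R).

(* f is analytic on D (for the disc: equivalently, given by a power series at 0
   converging on all of D) *)
Definition analytic_disc (f : C -> C) : Prop := exists a, taylor_on_disc f a.

Definition analytic_selfmap (phi : C -> C) : Prop :=
  analytic_disc phi /\ forall z, z \in disc -> phi z \in disc.

Definition H2_norm_le (f : C -> C) (r : R) : Prop :=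
  0 <= r /\ exists a, taylor_on_disc f a /\
    (\sum_(0 <= n <oo) ((cabs (a n)) ^+ 2)%:E <= (r ^+ 2)%:E)%E.

Definition H2 (f : C -> C) : Prop := exists r, H2_norm_le f r.

Definition comp_maps_H2 (phi : C -> C) : Prop :=
  forall f, H2 f -> H2 (f \o phi).

(* C_phi : H^2 -> H^2 is compact: the image of the closed unit ball is relatively
   compact, i.e. (H^2 being complete) every sequence in the unit ball has a
   subsequence whose images converge in H^2 *)
Definition comp_compact (phi : C -> C) : Prop :=
  forall f : nat -> C -> C, (forall k, H2_norm_le (f k) 1) ->
  exists sigma : nat -> nat, (forall k, (sigma k < sigma k.+1)%N) /\
  exists g, H2 g /\
    forall e : R, 0 < e ->
      \forall k \near \oo, H2_norm_le (fun z => f (sigma k) (phi z) - g z) e.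

Definition radial_limit (phi : C -> C) (t : R) (L : C) : Prop :=
  (fun r : R => cabs (phi (r%:C * expi t)%C - L)) @ at_left 1 --> (0 : R).

End HardyDefs.

(* Main.v *)
(** The symbols are [phi1 z = (1 + z) / 2] and [phi2 = S phi1], where
    [S z = exp (- (1 + z) / (1 - z))] is inner, so that both have the same boundary
    modulus. Near [z = 1] the factor [S] spins so fast that it spreads the mass that
    [phi1] concentrates there.

    [C_phi1] is not compact: the normalised reproducing kernels at real points
    [w -> 1] tend to [0] weakly, but their images, evaluated at [w], stay of norm
    at least [1].

    [C_phi2] is the norm limit of its restrictions to polynomials: by Schur's test
    this follows once the Gram entries [<phi2^n, phi2^m>] are small and summable in
    [n - m]. With [c_n = phi1^n], [d = n - m > 0] and [h] about [(n + m) / 2], writing the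
    derivation [z d/dz] as a symmetric operator and using
    [z S' = - 2 z (1 - z)^-2 S] gives
    [|<S^d c_n, c_m>| <= 7 g_h / (2 d)] with [g_h = |c_h|^2 = 4^-h binom(2h, h)]. The
    identity [g_h - g_(h+1) = g_h / (2 h + 2)] makes the sum over [d] telescope, and
    [g_h -> 0].

    All of this is done on real Taylor coefficients. The operator of multiplication
    by [S] is the time-one map of the semigroup with generator [- (1 + z) / (1 - z)];
    differentiating in time yields both its contractivity on truncated sequences and
    the pointwise values of [S]. *)
Require Import Defs.
From HB Require Import structures.
From mathcomp Require Import all_boot all_order all_algebra.
From mathcomp Require Import all_classical all_reals all_analysis.
From mathcomp Require Import complex.
From mathcomp Require Import ring lra zify.
Import Order.TTheory GRing.Theory Num.Theory.
Import numFieldNormedType.Exports.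
Set Implicit Arguments. Unset Strict Implicit. Unset Printing Implicit Defensive.
Local Open Scope classical_set_scope.
Local Open Scope ring_scope.

(** * Operators on coefficient sequences *)

(** The obstacle is the point [z = 1], where [z S' / S] has a double pole. Integration by parts is
    therefore done with [(1 - z)^2 c_n] in place of [c_n]: the square cancels the pole, and the Gram
    entry itself appears with the factor [2 d]. In the other terms the factors [1 - z] are divided
    between the two sides of the inner product, next to factors [n] and [m] from differentiating
    powers of [(1 + z) / 2]. The norm [|(1 - z) c_h|^2 = 4 (g_h - g_(h+1)) = 2 g_h / (h + 1)] pays
    for exactly these. On full sequences [<phi2^n, phi2^m> = <S^d c_n, c_m>], because [S] is an
    isometry. Sums over the first [K] coefficients only see a contraction; Horner's rule, which
    peels off one factor [S] at a time, adapts to this and produces just the entries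
    [<S^d c_n, c_m>]. Both symbols have real Taylor coefficients, so the matrix of the composition
    operator is real and acts separately on the real and imaginary parts of a coefficient
    sequence. *)

Section SequenceOperators.
Variable R : realFieldType.
Implicit Types (y u v : nat -> R) (F G : (nat -> R) -> nat -> R).

(* A sequence [y] stands for the power series [sum_k y_k z^k]: [shift_seq] is multiplication
   by [z], [psum] by [z / (1 - z)], [half_shift] by [(1 + z) / 2], [diff_seq] by [1 - z], and
   [euler] is [z d/dz]. *)
Definition shift_seq y k : R := if k is k'.+1 then y k' else 0.
Definition psum y k : R := \sum_(i < k) y i.
Definition unit_seq (k : nat) : R := (k == 0%N)%:R.
Definition half_shift y k : R := (y k + shift_seq y k) / 2.
Definition diff_seq y k : R := y k - shift_seq y k.
Definition euler y k : R := k%:R * y k.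
Definition dot_seq K u v : R := \sum_(k < K) u k * v k.

Definition linop F :=
  forall a u v, F (fun k => a * u k + v k) = fun k => a * F u k + F v k.

Lemma linop0 F : linop F -> F (fun=> 0) = fun=> 0.
Proof.
move=> lF; have := lF (-1) (fun=> 0) (fun=> 0).
rewrite (_ : (fun k : nat => -1 * 0 + 0) = (fun=> 0 : R)); last first.
  by apply/funext => k; rewrite mulr0 addr0.
by move=> ->; apply/funext => k; rewrite mulN1r addNr.
Qed.

Lemma linopZ F a u : linop F -> F (fun k => a * u k) = fun k => a * F u k.
Proof.
move=> lF; have := lF a u (fun=> 0); rewrite linop0//.
rewrite (_ : (fun k => a * u k + 0) = (fun k => a * u k)); last first.
  by apply/funext => k; rewrite addr0.
by move=> ->; apply/funext => k; rewrite addr0.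
Qed.

Lemma linopD F u v : linop F -> F (fun k => u k + v k) = fun k => F u k + F v k.
Proof.
move=> lF; have := lF 1 u v.
rewrite (_ : (fun k => 1 * u k + v k) = (fun k => u k + v k)); last first.
  by apply/funext => k; rewrite mul1r.
by move=> ->; apply/funext => k; rewrite mul1r.
Qed.

Lemma linopB F u v : linop F -> F (fun k => u k - v k) = fun k => F u k - F v k.
Proof.
move=> lF; have := lF (-1) v u.
rewrite (_ : (fun k => -1 * v k + u k) = (fun k => u k - v k)); last first.
  by apply/funext => k; rewrite mulN1r addrC.
by move=> ->; apply/funext => k; rewrite mulN1r addrC.
Qed.

Lemma linop_sum F n (a : nat -> R) (u : nat -> nat -> R) : linop F ->
  F (fun k => \sum_(i < n) a i * u i k) = fun k => \sum_(i < n) a i * F (u i) k.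
Proof.
move=> lF; elim: n => [|n IH].
  rewrite (_ : (fun k => _) = (fun=> 0)); last by apply/funext => k; rewrite big_ord0.
  by rewrite linop0//; apply/funext => k; rewrite big_ord0.
rewrite (_ : (fun k => _) = (fun k => a n * u n k + \sum_(i < n) a i * u i k)); last first.
  by apply/funext => k; rewrite big_ord_recr addrC.
by rewrite lF IH; apply/funext => k; rewrite big_ord_recr addrC.
Qed.

Lemma linop_iter F n : linop F -> linop (iter n F).
Proof. by move=> lF; elim: n => // n IH a u v /=; rewrite IH lF. Qed.

Lemma linop_shift : linop shift_seq.
Proof. by move=> a u v; apply/funext => -[|k] //=; rewrite mulr0 addr0. Qed.

Lemma linop_psum : linop psum.
Proof. by move=> a u v; apply/funext => k; rewrite /psum big_split -mulr_sumr. Qed.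

Lemma linop_half_shift : linop half_shift.
Proof. by move=> a u v; apply/funext => k; rewrite /half_shift linop_shift; field. Qed.

Lemma linop_diff : linop diff_seq.
Proof. by move=> a u v; apply/funext => k; rewrite /diff_seq linop_shift; ring. Qed.

Lemma iter_comm F G n y :
  (forall z, F (G z) = G (F z)) -> iter n F (G y) = G (iter n F y).
Proof. by move=> FG; elim: n => //= n ->. Qed.

Lemma comm_half_shift F y : linop F -> (forall z, F (shift_seq z) = shift_seq (F z)) ->
  F (half_shift y) = half_shift (F y).
Proof.
move=> lF FS; rewrite /half_shift.
rewrite (_ : (fun k => _) = (fun k => 2^-1 * (y k + shift_seq y k))); last first.
  by apply/funext => k; rewrite mulrC.
by rewrite linopZ// linopD// FS; apply/funext => k; rewrite mulrC.
Qed.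

Lemma comm_diff F y : linop F -> (forall z, F (shift_seq z) = shift_seq (F z)) ->
  F (diff_seq y) = diff_seq (F y).
Proof. by move=> lF FS; rewrite /diff_seq linopB// FS. Qed.

Lemma psumS y k : psum y k.+1 = psum y k + y k.
Proof. by rewrite /psum big_ord_recr. Qed.

Lemma psum0 y : psum y 0 = 0. Proof. by rewrite /psum big_ord0. Qed.

Lemma psum_shift y : psum (shift_seq y) = shift_seq (psum y).
Proof.
apply/funext; elim=> [|k IH]; first by rewrite psum0.
by rewrite psumS IH /=; case: k {IH} => [|k] /=; rewrite ?psum0 ?addr0// psumS.
Qed.

Lemma psum_diff y : psum (diff_seq y) = shift_seq y.
Proof.
apply/funext; elim=> [|k IH]; first by rewrite psum0.
by rewrite psumS IH /= /diff_seq; ring.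
Qed.

(** Product rule for [A = z / (1 - z)], which satisfies [z A' = A + A^2]. *)
Lemma euler_psum y :
  euler (psum y) = fun k => psum (euler y) k + (psum y k + psum (psum y) k).
Proof.
apply/funext; elim=> [|k IH]; first by rewrite /euler !psum0; ring.
by move: IH; rewrite /euler !psumS -[in X in _ -> X]natr1 => IH; rewrite mulrDl !mulrDr IH; ring.
Qed.

Lemma euler_iter_psum j y k :
  euler (iter j psum y) k = iter j psum (euler y) k
    + j%:R * (iter j psum y k + iter j.+1 psum y k).
Proof.
elim: j k => [|j IH] k; first by rewrite mul0r addr0.
rewrite iterS euler_psum.
have -> : euler (iter j psum y) = fun k =>
    j%:R * (iter j psum y k + iter j.+1 psum y k) + iter j psum (euler y) k.
  by apply/funext => i; rewrite IH addrC.
rewrite linop_psum (linopD _ _ linop_psum) !iterS -natr1; ring.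
Qed.

Lemma iter_psum_lt j y k : (k < j)%N -> iter j psum y k = 0.
Proof.
elim: j k => // j IH k kj; rewrite iterS /psum big1// => i _.
by apply: IH; apply: leq_trans (ltn_ord i) _.
Qed.

(** [A + A^2 = z / (1 - z)^2] for [A = z / (1 - z)] is, up to a constant, [z S' / S]; on multiples
    of [(1 - z)^2] the double pole cancels and a mere [z] is left. *)
Lemma diff2_psum y k : psum (diff_seq (diff_seq y)) k + psum (psum (diff_seq (diff_seq y))) k = shift_seq y k.
Proof.
by rewrite psum_diff psum_shift psum_diff; case: k => [|k] /=; rewrite /diff_seq; ring.
Qed.

Section Inner.
Variables (e t : R).

Definition laguerre_coef j : R := (- 2 * t) ^+ j / j`!%:R.
(* Multiplication by [e exp (- 2 t z / (1 - z))]; for [e = exp (- t)] this is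
   [exp (- t (1 + z) / (1 - z))]. *)
Definition inner_op y k : R := e * \sum_(j < k.+1) laguerre_coef j * iter j psum y k.

Lemma inner_opE J y k : (k < J)%N ->
  inner_op y k = e * \sum_(j < J) laguerre_coef j * iter j psum y k.
Proof.
move=> kJ; congr (_ * _); rewrite -!(big_mkord xpredT (fun j => laguerre_coef j * iter j psum y k)).
rewrite [RHS](big_cat_nat (n := k.+1))//= [X in _ + X]big_nat [X in _ + X]big1 ?addr0// => j.
by case/andP=> kj _; rewrite iter_psum_lt ?mulr0.
Qed.

Lemma linop_inner : linop inner_op.
Proof.
move=> a u v; apply/funext => k; rewrite /inner_op [a * _]mulrCA -mulrDr [X in X + _]mulr_sumr -big_split /=.
congr (_ * _); apply: eq_bigr => j _; rewrite (linop_iter _ linop_psum); ring.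
Qed.

(** Formally [inner_op] is a power series in [psum], so a linear map commuting with [psum] commutes
    with it. Locality (entry [k] of [F z] depends on [z] up to [k] only) lets one finite sum replace
    the series before [F] passes through. *)
Lemma inner_comm F y : linop F ->
  (forall z k, (forall i, (i <= k)%N -> z i = 0) -> F z k = 0) ->
  (forall z, F (psum z) = psum (F z)) -> inner_op (F y) = F (inner_op y).
Proof.
move=> lF locF FA; apply/funext => k.
pose w := fun i => e * \sum_(j < k.+1) laguerre_coef j * iter j psum y i.
have -> : F (inner_op y) k = F w k.
  apply/eqP; rewrite -subr_eq0; apply/eqP.
  have := linopB (inner_op y) w lF => /(congr1 (fun f => f k)) <-.
  by apply: locF => i ik; rewrite /w -inner_opE ?subrr.
rewrite /w (linopZ _ _ lF); have := linop_sum k.+1 laguerre_coef (fun j => iter j psum y) lF.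
move=> ->; congr (_ * _); apply: eq_bigr => j _.
by rewrite iter_comm.
Qed.

Lemma inner_shift y : inner_op (shift_seq y) = shift_seq (inner_op y).
Proof.
apply: inner_comm => [|z [|k] z0//=|z]; [exact: linop_shift|exact: z0|].
by rewrite psum_shift.
Qed.

Lemma inner_psum y : inner_op (psum y) = psum (inner_op y).
Proof.
apply: inner_comm => [|z k z0//=|z//]; first exact: linop_psum.
by rewrite /psum big1// => i _; rewrite z0// ltnW.
Qed.

Lemma inner_half_shift y : inner_op (half_shift y) = half_shift (inner_op y).
Proof. exact: (comm_half_shift _ linop_inner inner_shift). Qed.

Lemma inner_op0 y : inner_op y 0 = e * y 0%N.
Proof. by rewrite /inner_op big_ord1 /laguerre_coef fact0 /=; field. Qed.

Lemma laguerre_coefS j : j.+1%:R * laguerre_coef j.+1 = - 2 * t * laguerre_coef j.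
Proof.
rewrite /laguerre_coef factS natrM exprS; field.
by rewrite nat1r !pnatr_eq0 -lt0n fact_gt0.
Qed.

(* Sequence form of [z S' = - 2 t z (1 - z)^-2 S] for [S = exp (- t (1 + z) / (1 - z))]. *)
Lemma euler_inner y k : euler (inner_op y) k =
  inner_op (euler y) k - 2 * t * inner_op (fun i => psum y i + psum (psum y) i) k.
Proof.
(* The cutoff [k.+2] leaves room for the shift [j -> j.+1] made below by [laguerre_coefS]; the
   surplus last term on the right vanishes by [iter_psum_lt]. *)
rewrite {1}/euler (linopD _ _ linop_inner) !(@inner_opE k.+2)//.
rewrite mulrCA mulr_sumr.
have -> : \sum_(j < k.+2) k%:R * (laguerre_coef j * iter j psum y k) =
  \sum_(j < k.+2) laguerre_coef j * iter j psum (euler y) k +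
  \sum_(j < k.+2) j%:R * laguerre_coef j * (iter j psum y k + iter j.+1 psum y k).
  rewrite -big_split /=; apply: eq_bigr => j _.
  have := euler_iter_psum j y k; rewrite {1}/euler => E.
  by rewrite mulrCA E iterS; ring.
rewrite [X in _ + X]big_ord_recl mul0r mul0r add0r /=.
under [X in _ + X]eq_bigr => j _ do rewrite /bump /= add1n laguerre_coefS -(mulrA (- 2 * t)).
rewrite -mulr_sumr.
rewrite [X in - (_ * X)](_ : _ = e * \sum_(j < k.+1) laguerre_coef j * (iter j.+1 psum y k + iter j.+2 psum y k)).
  by rewrite mulrDr; congr (_ + _); rewrite mulrCA !mulNr.
rewrite -mulrDr -big_split big_ord_recr /=; congr (_ * _).
have A0 z : psum (iter k psum z) k = 0 by rewrite -iterS iter_psum_lt.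
rewrite !A0 mulr0 !addr0.
by apply: eq_bigr => j _; rewrite mulrDr -!iterSr.
Qed.

End Inner.
End SequenceOperators.

Arguments shift_seq {R} y k.
Arguments psum {R} y k.
Arguments unit_seq {R} k.
Arguments half_shift {R} y k.
Arguments diff_seq {R} y k.
Arguments euler {R} y k.
Arguments dot_seq {R} K u v.
Arguments inner_op {R} e t y k.

(** * Truncated inner products and central binomial coefficients *)

Section InnerProduct.
Variable R : realFieldType.
Implicit Types (y u v w : nat -> R).

Lemma dotE0 K u v : dot_seq K.+1 u v = dot_seq K u v + u K * v K.
Proof. by rewrite /dot_seq big_ord_recr. Qed.

Lemma dotC K u v : dot_seq K u v = dot_seq K v u.
Proof. by apply: eq_bigr => k _; rewrite mulrC. Qed.

Lemma dot_ge0 K u : 0 <= dot_seq K u u.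
Proof. by apply: sumr_ge0 => k _; rewrite -expr2 sqr_ge0. Qed.

Lemma dotDl K u v w : dot_seq K (fun k => u k + v k) w = dot_seq K u w + dot_seq K v w.
Proof. by rewrite /dot_seq -big_split; apply: eq_bigr => k _; rewrite mulrDl. Qed.

Lemma dotBl K u v w : dot_seq K (fun k => u k - v k) w = dot_seq K u w - dot_seq K v w.
Proof. by rewrite /dot_seq -sumrB; apply: eq_bigr => k _; rewrite mulrBl. Qed.

Lemma dotZl K a u w : dot_seq K (fun k => a * u k) w = a * dot_seq K u w.
Proof. by rewrite /dot_seq mulr_sumr; apply: eq_bigr => k _; rewrite mulrA. Qed.

Lemma dotDr K u v w : dot_seq K w (fun k => u k + v k) = dot_seq K w u + dot_seq K w v.
Proof. by rewrite dotC dotDl !(dotC _ w). Qed.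

Lemma dotBr K u v w : dot_seq K w (fun k => u k - v k) = dot_seq K w u - dot_seq K w v.
Proof. by rewrite dotC dotBl !(dotC _ w). Qed.

Lemma dotZr K a u w : dot_seq K w (fun k => a * u k) = a * dot_seq K w u.
Proof. by rewrite dotC dotZl !(dotC _ w). Qed.

Lemma dot_suml K n (a : nat -> R) (u : nat -> nat -> R) w :
  dot_seq K (fun k => \sum_(i < n) a i * u i k) w = \sum_(i < n) a i * dot_seq K (u i) w.
Proof.
rewrite /dot_seq; under eq_bigr => k _ do rewrite mulr_suml.
rewrite exchange_big; apply: eq_bigr => i _; rewrite mulr_sumr.
by apply: eq_bigr => k _; rewrite mulrA.
Qed.

Lemma dot_sqD K u v : dot_seq K (fun k => u k + v k) (fun k => u k + v k) =
  dot_seq K u u + 2 * dot_seq K v u + dot_seq K v v.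
Proof. rewrite dotDl !dotDr (dotC K u v); ring. Qed.

Lemma dot_AGM K u v : `|dot_seq K u v| <= (dot_seq K u u + dot_seq K v v) / 2.
Proof.
have H1 := dot_ge0 K (fun k => u k + v k).
have H2 := dot_ge0 K (fun k => u k - v k).
rewrite dotDl !dotDr (dotC K v u) in H1; rewrite dotBl !dotBr (dotC K v u) in H2.
rewrite ler_norml; by apply/andP; split; lra.
Qed.

Lemma dot_shiftS K u v : dot_seq K.+1 (shift_seq u) (shift_seq v) = dot_seq K u v.
Proof. by rewrite /dot_seq big_ord_recl /= mul0r add0r. Qed.

Lemma dot_shift_le K u : dot_seq K (shift_seq u) (shift_seq u) <= dot_seq K u u.
Proof.
case: K => [|K]; first by rewrite /dot_seq !big_ord0.
by rewrite dot_shiftS dotE0 lerDl -expr2 sqr_ge0.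
Qed.

Lemma dot_iter_shift_le K j u : dot_seq K (iter j shift_seq u) (iter j shift_seq u) <= dot_seq K u u.
Proof. by elim: j => //= j; apply: le_trans; exact: dot_shift_le. Qed.

(** Parallelogram law for [u] and [shift_seq u]. It yields both the contractivity of [half_shift]
    and the exact norm of [(1 - z) c_n]. *)
Lemma dot_half_shift_diff K u : 4 * dot_seq K (half_shift u) (half_shift u) =
  2 * (dot_seq K u u + dot_seq K (shift_seq u) (shift_seq u)) - dot_seq K (diff_seq u) (diff_seq u).
Proof.
rewrite /dot_seq -big_split !mulr_sumr -sumrB; apply: eq_bigr => k _ /=.
by rewrite /half_shift /diff_seq; field.
Qed.

Lemma dot_half_shift_le K u : dot_seq K (half_shift u) (half_shift u) <= dot_seq K u u.
Proof.
by have := dot_half_shift_diff K u; have := dot_shift_le K u; have := dot_ge0 K (diff_seq u); lra.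
Qed.

(** Entry 0 of [diff_seq u] is [u 0], which bounds the defect in the parallelogram law from below.
    This gain pays for the cross term in [bounded_pow_seq]. *)
Lemma dot_half_shift_le0 K u :
  dot_seq K.+1 (half_shift u) (half_shift u) <= dot_seq K.+1 u u - u 0%N ^+ 2 / 4.
Proof.
have : u 0%N ^+ 2 <= dot_seq K.+1 (diff_seq u) (diff_seq u).
  rewrite /dot_seq big_ord_recl /= {1 2}/diff_seq /= subr0 -expr2 lerDl.
  by apply: sumr_ge0 => k _; rewrite -expr2 sqr_ge0.
by have := dot_half_shift_diff K.+1 u; have := dot_shift_le K.+1 u; lra.
Qed.

(** If one factor is a polynomial of degree well below [K], the truncated product is the full one
    and the shift preserves it. *)
Definition deg_le m v := forall k, (m < k)%N -> v k = 0.

Lemma deg_le_shift m v : deg_le m v -> deg_le m.+1 (shift_seq v).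
Proof. by move=> h [|k] // mk /=; exact: h. Qed.

Lemma deg_le_half_shift m v : deg_le m v -> deg_le m.+1 (half_shift v).
Proof.
by move=> h k mk; rewrite /half_shift (deg_le_shift h)// h ?addr0 ?mul0r// ltnW.
Qed.

Lemma deg_le_diff m v : deg_le m v -> deg_le m.+1 (diff_seq v).
Proof. by move=> h k mk; rewrite /diff_seq (deg_le_shift h)// h ?subr0// ltnW. Qed.

Lemma dot_shift K m u v : deg_le m v -> (m.+1 < K)%N ->
  dot_seq K (shift_seq u) (shift_seq v) = dot_seq K u v.
Proof. by move=> h; case: K => // K mK; rewrite dot_shiftS dotE0 h ?mulr0 ?addr0. Qed.

(** On the circle [(1 - z) conj z = - conj (1 - z)]. *)
Lemma dot_diff_shift K m u v : deg_le m v -> (m.+1 < K)%N ->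
  dot_seq K (diff_seq u) (shift_seq v) = - dot_seq K u (diff_seq v).
Proof. by move=> h mK; rewrite dotBl (dot_shift _ h)// dotBr opprB. Qed.

Lemma dot_half_shift_shift K m u v : deg_le m v -> (m.+1 < K)%N ->
  dot_seq K (half_shift u) (shift_seq v) = dot_seq K u (half_shift v).
Proof.
move=> h mK; rewrite /half_shift.
rewrite (_ : (fun k => (u k + _) / 2) = (fun k => 2^-1 * (u k + shift_seq u k))); last first.
  by apply/funext => k; rewrite mulrC.
rewrite (_ : (fun k => (v k + _) / 2) = (fun k => 2^-1 * (v k + shift_seq v k))); last first.
  by apply/funext => k; rewrite mulrC.
by rewrite dotZl dotZr dotDl dotDr (dot_shift _ h)// addrC.
Qed.

Lemma half_shift_shift u : half_shift (shift_seq u) = shift_seq (half_shift u).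
Proof. by apply/funext => -[|k] //=; rewrite /half_shift /= addr0 mul0r. Qed.

Lemma diff_shift u : diff_seq (shift_seq u) = shift_seq (diff_seq u).
Proof. by apply/funext => -[|k] //=; rewrite /diff_seq /= subr0. Qed.

Lemma half_shift_diff u : half_shift (diff_seq u) = diff_seq (half_shift u).
Proof.
rewrite comm_diff//; [exact: linop_half_shift|exact: half_shift_shift].
Qed.

(* On the circle [conj ((1 + z) / 2) = z^-1 (1 + z) / 2]: factors [(1 + z) / 2] may
   be moved across the inner product at the price of shifts. *)
Lemma dot_iter_half_shift K m j u v : deg_le m v -> (m + j.+1 < K)%N ->
  dot_seq K (iter j half_shift u) v = dot_seq K (iter j shift_seq u) (iter j half_shift v).
Proof.
elim: j m u v => [//|j IH] m u v h mK.
rewrite iterS -(dot_shift _ h); last by lia.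
rewrite -half_shift_shift (dot_half_shift_shift _ h); last by lia.
rewrite -(iter_comm _ _ half_shift_shift) (IH m.+1 (shift_seq u)); last 2 first.
- exact: deg_le_half_shift.
- by lia.
by rewrite -!iterSr.
Qed.

Let exp2_neq0 n : 2 ^+ n != 0 :> R.
Proof. by rewrite expf_neq0// pnatr_eq0. Qed.

Let exp4_neq0 n : 4 ^+ n != 0 :> R.
Proof. by rewrite expf_neq0// pnatr_eq0. Qed.

Definition binom_seq n : nat -> R := iter n half_shift unit_seq.

Lemma binom_seqE n k : binom_seq n k = 'C(n, k)%:R / 2 ^+ n.
Proof.
elim: n k => [|n IH] k; first by case: k => [|k]; rewrite ?bin0 ?bin0n expr0 divr1.
rewrite /= /half_shift -/(binom_seq n) IH exprS; case: k => [|k] /=.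
  by rewrite !bin0; field; rewrite exp2_neq0.
by rewrite -/(binom_seq n) IH binS natrD; field; rewrite exp2_neq0.
Qed.

Lemma binom_seqS n : binom_seq n.+1 = half_shift (binom_seq n). Proof. by []. Qed.

Lemma deg_le_binom n : deg_le n (binom_seq n).
Proof. by move=> k nk; rewrite binom_seqE bin_small// mul0r. Qed.

(** Derivative of a power of [(1 + z) / 2]; at [n = 0] the value [n.-1 = 0] is harmless because the
    factor [n] vanishes. *)
Lemma euler_binom n :
  euler (binom_seq n) = fun k => n%:R / 2 * shift_seq (binom_seq n.-1) k.
Proof.
apply/funext => -[|k]; rewrite /euler /=; first by rewrite mul0r mulr0.
rewrite !binom_seqE; case: n => [|n]; first by rewrite bin0n !mul0r mulr0.
have := congr1 (fun i => i%:R : R) (mul_bin_diag n.+1 k); rewrite !natrM => E.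
by rewrite (mulrA k.+1%:R) -E exprS /=; field; rewrite exp2_neq0.
Qed.

Definition central n : R := 'C(n.*2, n)%:R / 4 ^+ n.

Lemma dot_binom K n : (n < K)%N -> dot_seq K (binom_seq n) (binom_seq n) = central n.
Proof.
move=> nK; rewrite /dot_seq -(big_mkord xpredT (fun k => binom_seq n k * binom_seq n k)).
rewrite (big_cat_nat (n := n.+1))//= [X in _ + X]big_nat [X in _ + X]big1 ?addr0; last first.
  by move=> k /andP[nk _]; rewrite deg_le_binom ?mul0r.
rewrite big_mkord /central -addnn -binomial.Vandermonde natr_sum mulr_suml.
apply: eq_bigr => k _; have kn : (k <= n)%N by rewrite -ltnS.
have e4 : 4 ^+ n = 2 ^+ n * 2 ^+ n :> R by rewrite -exprMn -natrM.
by rewrite !binom_seqE (bin_sub kn) natrM e4 invfM mulrACA.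
Qed.

Lemma centralS n : central n.+1 * (2 * n%:R + 2) = central n * (2 * n%:R + 1).
Proof.
have E : ('C(n.+1.*2, n.+1) * n.+1 = 2 * (n.*2.+1 * 'C(n.*2, n)))%N.
  have E1 := mul_bin_diag n.+1.*2 n; have E2 := mul_bin_down n.*2.+1 n.
  rewrite (_ : n.*2.+1 - n = n.+1)%N in E2; last by lia.
  rewrite mulnC -E1 doubleS /= E2; lia.
have {}E : 'C(n.+1.*2, n.+1)%:R * (n%:R + 1) = 2 * ((2 * n%:R + 1) * 'C(n.*2, n)%:R) :> R.
  have n2 : n.*2.+1%:R = 2 * n%:R + 1 :> R by rewrite -natr1 -mul2n natrM.
  by have := congr1 (fun k => k%:R : R) E; rewrite !natrM n2 -(natr1 n).
rewrite /central exprS.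
have -> : 'C(n.+1.*2, n.+1)%:R / (4 * 4 ^+ n) * (2 * n%:R + 2) =
   2 * ('C(n.+1.*2, n.+1)%:R * (n%:R + 1)) / (4 * 4 ^+ n) :> R by ring.
by rewrite E; field; rewrite ?exp2_neq0 ?exp4_neq0.
Qed.

Lemma central_ge0 n : 0 <= central n.
Proof. by rewrite divr_ge0// exprn_ge0. Qed.

Lemma central_diff n : central n - central n.+1 = central n / (2 * n%:R + 2).
Proof.
have p : 0 < 2 * n%:R + 2 :> R by have := ler0n R n; lra.
apply: (mulIf (lt0r_neq0 p)); rewrite mulrBl centralS divfK ?lt0r_neq0//; ring.
Qed.

Lemma central_decr n m : (n <= m)%N -> central m <= central n.
Proof.
elim: m => [|m IH]; first by rewrite leqn0 => /eqP ->.
rewrite leq_eqVlt => /orP[/eqP ->//|nm]; apply: le_trans (IH nm).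
rewrite -subr_ge0 central_diff; apply: divr_ge0; first exact: central_ge0.
by have := ler0n R m; lra.
Qed.

(** A Wallis-type bound. The induction closes because [(2 n + 2)^2 (n + 1) - (2 n + 1)^2 (n + 2) = 3
    n + 2] is positive. *)
Lemma central_sq_le n : central n ^+ 2 * (n%:R + 1) <= 1.
Proof.
elim: n => [|n IH]; first by rewrite /central bin0 expr0 divr1 expr1n add0r mulr1.
have n0 := ler0n R n; apply: le_trans IH; rewrite -natr1.
have p : 0 < (2 * n%:R + 2) ^+ 2 :> R by rewrite exprn_gt0//; lra.
rewrite -(ler_pM2r p).
rewrite (_ : _ * (2 * n%:R + 2) ^+ 2 = (central n.+1 * (2 * n%:R + 2)) ^+ 2 * (n%:R + 1 + 1)); last by ring.
rewrite centralS -subr_ge0.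
rewrite (_ : _ - _ = central n ^+ 2 * (3 * n%:R + 2)); last by ring.
by rewrite mulr_ge0 ?sqr_ge0//; lra.
Qed.

(** By the parallelogram law the norm is [4 (g_n - g_(n+1))], a difference of consecutive values.
    The gain of a factor [1 / (n + 1)] over [|c_n|^2] compensates the factor [n] from
    differentiation. *)
Lemma dot_diff_binom K n : (n.+1 < K)%N ->
  dot_seq K (diff_seq (binom_seq n)) (diff_seq (binom_seq n)) * (n%:R + 1) = 2 * central n.
Proof.
move=> nK; have := dot_half_shift_diff K (binom_seq n).
rewrite -binom_seqS (dot_shift _ (@deg_le_binom n))// !dot_binom//; last by apply: ltnW.
have := central_diff n; have n0 := ler0n R n.
move=> E1 E2.
have -> : dot_seq K (diff_seq (binom_seq n)) (diff_seq (binom_seq n)) = 4 * (central n - central n.+1) by lra.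
by rewrite E1; field; apply/lt0r_neq0; lra.
Qed.

Lemma half_shift_iter_binom n j : iter j half_shift (binom_seq n) = binom_seq (n + j).
Proof. by rewrite addnC /binom_seq iterD. Qed.

Lemma dot_diff_binom_decr K n m : (n <= m)%N ->
  dot_seq K (diff_seq (binom_seq m)) (diff_seq (binom_seq m)) <=
  dot_seq K (diff_seq (binom_seq n)) (diff_seq (binom_seq n)).
Proof.
move/subnKC => <-; elim: (m - n)%N => [|j IH]; first by rewrite addn0.
rewrite addnS binom_seqS -half_shift_diff.
exact: le_trans (dot_half_shift_le _ _) IH.
Qed.

End InnerProduct.

(** * Gram entries *)

Section Gram.
Variable R : realFieldType.
Implicit Types (y u v w : nat -> R).

Lemma euler_shift y : euler (shift_seq y) = fun k => shift_seq (euler y) k + shift_seq y k.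
Proof.
apply/funext => -[|k]; rewrite /euler /=; first by rewrite mul0r addr0.
by rewrite -natr1 mulrDl mul1r.
Qed.

Lemma euler_diff y : euler (diff_seq y) = fun k => diff_seq (euler y) k - shift_seq y k.
Proof.
apply/funext => k; have := congr1 (fun f => f k) (euler_shift y).
by rewrite /diff_seq /euler => E; rewrite mulrBr E; ring.
Qed.

Lemma dot_euler K u v : dot_seq K (euler u) v = dot_seq K u (euler v).
Proof. by apply: eq_bigr => k _; rewrite /euler mulrCA mulrA. Qed.

Lemma euler_diff2_binom n k : euler (diff_seq (diff_seq (binom_seq R n))) k =
  n%:R / 2 * shift_seq (diff_seq (diff_seq (binom_seq R n.-1))) k - 2 * shift_seq (diff_seq (binom_seq R n)) k.
Proof.
rewrite !euler_diff (linopB _ _ (@linop_diff R)) euler_binom diff_shift.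
rewrite !(linopZ _ _ (@linop_diff R)) !diff_shift; ring.
Qed.

(** * Gram entries for an abstract contraction [T] that behaves like multiplication by [S] *)

Section Contraction.
Variable T : (nat -> R) -> nat -> R.
Hypothesis linT : linop T.
Hypothesis shiftT : forall y, T (shift_seq y) = shift_seq (T y).
Hypothesis psumT : forall y, T (psum y) = psum (T y).
Hypothesis contrT : forall K y, dot_seq K (T y) (T y) <= dot_seq K y y.
Hypothesis eulerT : forall y k, euler (T y) k =
  T (euler y) k - 2 * T (fun i => psum y i + psum (psum y) i) k.

Local Notation Tn d := (iter d T).

Lemma iter_shiftT d y : Tn d (shift_seq y) = shift_seq (Tn d y).
Proof. exact: (iter_comm _ _ shiftT). Qed.

Lemma iter_diffT d y : Tn d (diff_seq y) = diff_seq (Tn d y).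
Proof. exact: (comm_diff _ (linop_iter _ linT) (iter_shiftT d)). Qed.

Lemma iter_contrT d K y : dot_seq K (Tn d y) (Tn d y) <= dot_seq K y y.
Proof. by elim: d => //= d; apply: le_trans; exact: contrT. Qed.

Lemma euler_iterT d y k : euler (Tn d y) k =
  Tn d (euler y) k - 2 * d%:R * Tn d (fun i => psum y i + psum (psum y) i) k.
Proof.
elim: d k => [|d IH] k; first by rewrite mulr0 mul0r subr0.
have psTn z : Tn d (psum z) = psum (Tn d z) by exact: (iter_comm _ _ psumT).
rewrite /= eulerT.
have -> : euler (Tn d y) = fun i => (- (2 * d%:R)) *
    Tn d (fun i => psum y i + psum (psum y) i) i + Tn d (euler y) i.
  by apply/funext => i; rewrite IH; ring.
rewrite linT.
have -> : (fun i => psum (Tn d y) i + psum (psum (Tn d y)) i) =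
   Tn d (fun i => psum y i + psum (psum y) i).
  by rewrite (linopD _ _ (linop_iter _ linT)) !psTn.
rewrite -natr1; ring.
Qed.

Local Notation c := (binom_seq R).
Local Notation gram K n m d := (dot_seq K (Tn d (c n)) (c m)).

(* Integration by parts along the circle, against [euler]. *)
Lemma gram_by_parts K n m d : (m.+3 < K)%N ->
  2 * d%:R * gram K n m d =
    - (n%:R / 2) * dot_seq K (shift_seq (Tn d (diff_seq (c n.-1)))) (diff_seq (c m))
    - 2 * dot_seq K (Tn d (diff_seq (c n))) (c m)
    + m%:R / 2 * dot_seq K (Tn d (diff_seq (c n))) (shift_seq (diff_seq (c m.-1)))
    + dot_seq K (Tn d (diff_seq (c n))) (diff_seq (c m)).
Proof.
move=> mK; have dm := @deg_le_binom R m.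
have linTn := linop_iter d linT.
(* The test vectors are [S^d (1 - z)^2 c_n] and [z c_m]. The derivative of [S^d] becomes
   [- 2 d z S^d] after cancellation of the pole, and the [z] in front of [c_m] absorbs that shift,
   so that the plain Gram entry comes out. *)
have := dot_euler K (Tn d (diff_seq (diff_seq (c n)))) (shift_seq (c m)).
have -> : euler (Tn d (diff_seq (diff_seq (c n)))) = fun k =>
    n%:R / 2 * shift_seq (Tn d (diff_seq (diff_seq (c n.-1)))) k
    - (2 * shift_seq (Tn d (diff_seq (c n))) k + 2 * d%:R * shift_seq (Tn d (c n)) k).
  apply/funext => k; rewrite euler_iterT.
  rewrite (_ : (fun i => _ + _) = shift_seq (c n)); last first.
    by apply/funext => i; exact: diff2_psum.
  rewrite (_ : euler _ = fun k => n%:R / 2 * shift_seq (diff_seq (diff_seq (c n.-1))) k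
     - 2 * shift_seq (diff_seq (c n)) k); last by apply/funext => i; exact: euler_diff2_binom.
  rewrite (linopB _ _ linTn) !(linopZ _ _ linTn) !iter_shiftT; ring.
rewrite dotBl dotDl !dotZl !(dot_shift _ dm); [|by lia..].
rewrite euler_shift euler_binom dotDr.
have -> : shift_seq (fun k => m%:R / 2 * shift_seq (c m.-1) k) =
   fun k => m%:R / 2 * shift_seq (shift_seq (c m.-1)) k.
  exact: (linopZ _ _ (@linop_shift R)).
rewrite dotZr.
(* One of the two factors [1 - z] is moved to the other side in each term. With one factor per side,
   Cauchy-Schwarz can use [|(1 - z) c_h|^2] in full. *)
have E1 : dot_seq K (Tn d (diff_seq (diff_seq (c n.-1)))) (c m) =
   - dot_seq K (shift_seq (Tn d (diff_seq (c n.-1)))) (diff_seq (c m)).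
  rewrite -(dot_shift _ dm) ?(iter_diffT d (diff_seq _)) -?diff_shift; last by lia.
  by rewrite (dot_diff_shift _ dm)//; lia.
have E2 : dot_seq K (Tn d (diff_seq (diff_seq (c n)))) (shift_seq (shift_seq (c m.-1))) =
   - dot_seq K (Tn d (diff_seq (c n))) (shift_seq (diff_seq (c m.-1))).
  rewrite (iter_diffT d (diff_seq _)) (dot_diff_shift (m := m.-1.+1)) ?diff_shift//.
    exact/deg_le_shift/deg_le_binom.
  by lia.
have E3 : dot_seq K (Tn d (diff_seq (diff_seq (c n)))) (shift_seq (c m)) =
   - dot_seq K (Tn d (diff_seq (c n))) (diff_seq (c m)).
  by rewrite (iter_diffT d (diff_seq _)) (dot_diff_shift _ dm)//; lia.
rewrite E1 E2 E3 => E; lra.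
Qed.

(* Cauchy-Schwarz after balancing the powers of [(1 + z) / 2] on both sides. *)
Lemma dot_balance F G K n m h : linop F -> linop G ->
  (forall y, F (shift_seq y) = shift_seq (F y)) -> (forall y, G (shift_seq y) = shift_seq (G y)) ->
  (forall i, deg_le i.+2 (G (c i))) -> (h <= n)%N -> (n + m + 5 < K)%N ->
  2 * `|dot_seq K (F (c n)) (G (c m))| <=
  dot_seq K (F (c h)) (F (c h)) + dot_seq K (G (c (m + (n - h)))) (G (c (m + (n - h)))).
Proof.
move=> lF lG FS GS dG hn nK.
rewrite -{1}(subnKC hn) -half_shift_iter_binom.
rewrite -(iter_comm (F := half_shift) (G := F)); last first.
  by move=> z; rewrite comm_half_shift.
rewrite (dot_iter_half_shift _ (dG m)); last by lia.
rewrite (iter_comm (F := half_shift) (G := G)) ?half_shift_iter_binom; last first.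
  by move=> z; rewrite comm_half_shift.
have := dot_AGM K (iter (n - h) shift_seq (F (c h))) (G (c (m + (n - h)))).
have := dot_iter_shift_le K (n - h) (F (c h)); lra.
Qed.

(** The exponent [h] lies just below [(n + m) / 2]: after balancing, both vectors have exponent at
    least [h], even when differentiation has lowered [n] or [m] by one. As the norms decrease in the
    exponent, all four terms of [gram_by_parts] are bounded by values at [h]. *)
Lemma gram_le K n m d h : (h < n)%N -> (m <= n)%N -> (2 * h <= n + m - 1)%N ->
  (n + m <= 2 * h + 2)%N -> (n + m + 5 < K)%N ->
  2 * d%:R * `|gram K n m d| <= 7 * central R h.
Proof.
move=> hn mn h1 h2 nK; pose D := dot_seq K (diff_seq (c h)) (diff_seq (c h)).
have D0 : 0 <= D by exact: dot_ge0.
have linTn := linop_iter d linT.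
have lTD : linop (fun y => Tn d (diff_seq y)).
  by move=> a u v; rewrite linop_diff linTn.
have TDS y : Tn d (diff_seq (shift_seq y)) = shift_seq (Tn d (diff_seq y)).
  by rewrite diff_shift iter_shiftT.
have lS : linop (fun y => shift_seq (Tn d (diff_seq y))).
  by move=> a u v; rewrite linop_diff linTn linop_shift.
have lSD : linop (fun y : nat -> R => shift_seq (diff_seq y)).
  by move=> a u v; rewrite linop_diff linop_shift.
have degD i : deg_le i.+2 (diff_seq (c i)).
  by move=> k ik; apply: (deg_le_diff (@deg_le_binom R i)); lia.
have degSD i : deg_le i.+2 (shift_seq (diff_seq (c i))).
  exact/deg_le_shift/deg_le_diff/deg_le_binom.
have degc i : deg_le i.+2 (c i) by move=> k ik; apply: deg_le_binom; lia.
have TDD : dot_seq K (Tn d (diff_seq (c h))) (Tn d (diff_seq (c h))) <= D by exact: iter_contrT.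
have STDD : dot_seq K (shift_seq (Tn d (diff_seq (c h)))) (shift_seq (Tn d (diff_seq (c h)))) <= D.
  exact: le_trans (dot_shift_le _ _) TDD.
have B1 : `|dot_seq K (shift_seq (Tn d (diff_seq (c n.-1)))) (diff_seq (c m))| <= D.
  have := dot_balance (F := fun y => shift_seq (Tn d (diff_seq y))) (G := diff_seq) (K := K)
    (n := n.-1) (m := m) (h := h) lS (@linop_diff R) _ (@diff_shift R) degD.
  move=> /(_ (fun y => congr1 shift_seq (TDS y)) ltac:(lia) ltac:(lia)).
  have : dot_seq K (diff_seq (c (m + (n.-1 - h)))) (diff_seq (c (m + (n.-1 - h)))) <= D.
    by apply: dot_diff_binom_decr; lia.
  lra.
have B2 : `|dot_seq K (Tn d (diff_seq (c n))) (c m)| <= (D + central R h) / 2.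
  have := dot_balance (F := fun y => Tn d (diff_seq y)) (G := id) (K := K)
    (n := n) (m := m) (h := h) lTD _ TDS (fun=> erefl) degc.
  move=> /(_ (fun _ _ _ => erefl) ltac:(lia) ltac:(lia)) /=.
  rewrite dot_binom; last by lia.
  have : central R (m + (n - h)) <= central R h by apply: central_decr; lia.
  lra.
have B3 : `|dot_seq K (Tn d (diff_seq (c n))) (shift_seq (diff_seq (c m.-1)))| <= D.
  have := dot_balance (F := fun y => Tn d (diff_seq y)) (G := fun y => shift_seq (diff_seq y)) (K := K)
    (n := n) (m := m.-1) (h := h) lTD lSD TDS _ degSD.
  move=> /(_ (fun y => congr1 shift_seq (diff_shift y)) ltac:(lia) ltac:(lia)) /=.
  have : dot_seq K (shift_seq (diff_seq (c (m.-1 + (n - h))))) (shift_seq (diff_seq (c (m.-1 + (n - h))))) <= D.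
    by apply: le_trans (dot_shift_le _ _) _; apply: dot_diff_binom_decr; lia.
  lra.
have B4 : `|dot_seq K (Tn d (diff_seq (c n))) (diff_seq (c m))| <= D.
  have := dot_balance (F := fun y => Tn d (diff_seq y)) (G := diff_seq) (K := K)
    (n := n) (m := m) (h := h) lTD (@linop_diff R) TDS (@diff_shift R) degD.
  move=> /(_ ltac:(lia) ltac:(lia)) /=.
  have : dot_seq K (diff_seq (c (m + (n - h)))) (diff_seq (c (m + (n - h)))) <= D.
    by apply: dot_diff_binom_decr; lia.
  lra.
have -> : 2 * d%:R * `|gram K n m d| = `|2 * d%:R * gram K n m d|.
  by rewrite normrM ger0_norm// mulr_ge0.
rewrite gram_by_parts; last by lia.
have n0 : 0 <= n%:R / 2 :> R by rewrite divr_ge0.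
have m0 : 0 <= m%:R / 2 :> R by rewrite divr_ge0.
have h0 : (0 : R) <= h%:R by [].
have DE : D * (h%:R + 1) = 2 * central R h by apply: dot_diff_binom; lia.
have nmh : n%:R + m%:R <= 2 * h%:R + 2 :> R.
  by rewrite -natrD -(natrM _ 2 h) -(natrD _ _ 2) ler_nat.
(* Origin of the 7: [(h + 1) D = 2 g_h], then [2 D <= 4 g_h], and one more [g_h] from the term in
   which [c_m] carries no factor [1 - z]. *)
have bnd : (n%:R / 2 + m%:R / 2 + 2) * D + central R h <= 7 * central R h.
  have : (n%:R / 2 + m%:R / 2 + 2) * D <= (h%:R + 1 + 2) * D.
    by apply: ler_wpM2r => //; lra.
  have : D <= 2 * central R h by rewrite -DE mulrDr mulr1 lerDr mulr_ge0.
  lra.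
apply: le_trans bnd.
apply: le_trans (ler_normD _ _) _.
have A1 := ler_normD (- (n%:R / 2) * dot_seq K (shift_seq (Tn d (diff_seq (c n.-1)))) (diff_seq (c m))
    - 2 * dot_seq K (Tn d (diff_seq (c n))) (c m)) (m%:R / 2 * dot_seq K (Tn d (diff_seq (c n))) (shift_seq (diff_seq (c m.-1)))).
have A2 := ler_normB (- (n%:R / 2) * dot_seq K (shift_seq (Tn d (diff_seq (c n.-1)))) (diff_seq (c m)))
    (2 * dot_seq K (Tn d (diff_seq (c n))) (c m)).
have C1 : `|- (n%:R / 2) * dot_seq K (shift_seq (Tn d (diff_seq (c n.-1)))) (diff_seq (c m))| <= n%:R / 2 * D.
  by rewrite normrM normrN (ger0_norm n0) ler_wpM2l.
have C2 : `|2 * dot_seq K (Tn d (diff_seq (c n))) (c m)| <= D + central R h.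
  by rewrite normrM (ger0_norm (ler0n _ 2)); lra.
have C3 : `|m%:R / 2 * dot_seq K (Tn d (diff_seq (c n))) (shift_seq (diff_seq (c m.-1)))| <= m%:R / 2 * D.
  by rewrite normrM (ger0_norm m0) ler_wpM2l.
lra.
Qed.

End Contraction.
End Gram.

(** * Summation of the Gram bounds and smallness of the tail *)

Section GramSums.
Variable R : archiRealFieldType.
Implicit Types (y u v w b : nat -> R).

Lemma central_small (e : R) : 0 < e -> exists n, central R n <= e.
Proof.
move=> e0; have := archi_boundP (ltW (_ : 0 < (e ^+ 2)^-1)).
rewrite invr_gt0 exprn_gt0// => /(_ isT); set n := Num.bound _ => nE.
exists n; suff : central R n ^+ 2 <= e ^+ 2.
  by rewrite ler_pXn2r// nnegrE ?central_ge0 ?ltW.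
have n0 : 0 < n%:R + 1 :> R by rewrite ltr_pwDr.
rewrite -(ler_pM2r n0); apply: le_trans (central_sq_le R n) _.
have e2 : 0 < e ^+ 2 by rewrite exprn_gt0.
move: nE; rewrite -(ltr_pM2l e2) (mulfV (lt0r_neq0 e2)); lra.
Qed.

(** Bound for entries with [n - m = d] and [m >= N]: the middle exponent is at least [N] and at
    least [(d - 1) / 2], and [7 / 2] is rounded up to 4. The entry [N] of the maximum gives
    smallness for bounded [d], the other one summability in [d]. *)
Definition gram_bound N d : R :=
  if d is 0 then central R N else 4 * central R (maxn N d.-1./2) / d%:R.
Arguments gram_bound : simpl never.

Lemma gram_bound_ge0 N d : 0 <= gram_bound N d.
Proof. by rewrite /gram_bound; case: d => [|d]; rewrite ?central_ge0// divr_ge0// mulr_ge0// central_ge0. Qed.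

Lemma gram_bound_leN N d : gram_bound N d.+1 <= 4 * central R N.
Proof.
rewrite /gram_bound ler_pdivrMr//; have g0 := central_ge0 R N.
have : central R (maxn N d./2) <= central R N by apply: central_decr; exact: leq_maxl.
rewrite -natr1; have := ler0n R d; nra.
Qed.

(* [central n - central n.+1 = central n / (2 n + 2)], so the bound telescopes. *)
Lemma gram_bound_telescope N d : gram_bound N d.+1 <=
  8 * (central R d./2 + central R d.+1./2) - 8 * (central R d.+1./2 + central R d.+2./2).
Proof.
(* [g_(d/2)] moves only at every second [d]; adding its neighbour makes each step contribute one
   full difference [g_h - g_(h+1)]. *)
rewrite (_ : _ - _ = 8 * (central R d./2 - central R d./2.+1)); last first.
  by rewrite (_ : d.+2./2 = d./2.+1)//; ring.
rewrite central_diff /gram_bound ler_pdivrMr//.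
have g0 := central_ge0 R d./2.
have : central R (maxn N d./2) <= central R d./2 by apply: central_decr; exact: leq_maxr.
have h0 : 0 < 2 * (d./2)%:R + 2 :> R by have := ler0n R d./2; lra.
have hd : (d./2)%:R + 1 <= d.+1%:R :> R by rewrite natr1 ler_nat; lia.
move=> le1; apply: le_trans (_ : 4 * central R d./2 <= _); first by lra.
rewrite -subr_ge0.
rewrite (_ : _ - _ = 8 * central R d./2 * (d.+1%:R - ((d./2)%:R + 1)) / (2 * (d./2)%:R + 2)).
  apply: divr_ge0; last exact: ltW.
  apply: mulr_ge0; last by rewrite subr_ge0.
  exact: mulr_ge0.
by field; exact/lt0r_neq0.
Qed.

(** Up to [D] each term is at most [4 g_N]; beyond [D] the sum telescopes. Choosing first [D] and
    then [N] large makes the total small. *)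
Lemma gram_bound_sum N D L : \sum_(1 <= d < L.+1) gram_bound N d <=
  4 * D%:R * central R N + 16 * central R D./2.
Proof.
have near M : \sum_(1 <= d < M.+1) gram_bound N d <= 4 * M%:R * central R N.
  elim: M => [|M IH]; first by rewrite big_nil mulr0 mul0r.
  rewrite big_nat_recr//= -natr1.
  have := gram_bound_leN N M; lra.
have far p : \sum_(D.+1 <= d < D.+1 + p) gram_bound N d <=
    8 * (central R D./2 + central R D.+1./2)
    - 8 * (central R (D + p)./2 + central R (D + p).+1./2).
  elim: p => [|p IH]; first by rewrite !addn0 big_geq// subrr.
  rewrite addnS big_nat_recr ?leq_addr//= addSn addnS.
  have := gram_bound_telescope N (D + p); lra.
case: (leqP L D) => LD.
  apply: le_trans (near L) _.
  have LD' : L%:R <= D%:R :> R by rewrite ler_nat.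
  have := ler_wpM2r (central_ge0 R N) LD'; have := central_ge0 R D./2; lra.
rewrite (big_cat_nat (n := D.+1))//=; last by rewrite ltnS ltnW.
apply: lerD; first exact: near.
have -> : L.+1 = (D.+1 + (L - D))%N by lia.
apply: le_trans (far _) _.
have : central R D.+1./2 <= central R D./2 by apply: central_decr; rewrite half_leq.
have := central_ge0 R (D + (L - D))./2.
have := central_ge0 R (D + (L - D)).+1./2.
lra.
Qed.

Section Contraction.
Variable T : (nat -> R) -> nat -> R.
Hypothesis linT : linop T.
Hypothesis shiftT : forall y, T (shift_seq y) = shift_seq (T y).
Hypothesis psumT : forall y, T (psum y) = psum (T y).
Hypothesis contrT : forall K y, dot_seq K (T y) (T y) <= dot_seq K y y.
Hypothesis eulerT : forall y k, euler (T y) k =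
  T (euler y) k - 2 * T (fun i => psum y i + psum (psum y) i) k.

Local Notation Tn d := (iter d T).
Local Notation c := (binom_seq R).

Lemma gram_le_bound N K m d : (N <= m)%N -> (2 * (m + d) + 5 < K)%N ->
  `|dot_seq K (Tn d (c (m + d))) (c m)| <= gram_bound N d.
Proof.
move=> Nm mK; case: d mK => [|d] mK.
  rewrite /gram_bound /= addn0 dot_binom; last by lia.
  by rewrite ger0_norm ?central_ge0// central_decr.
have := gram_le linT shiftT psumT contrT eulerT d.+1 (K := K) (n := m + d.+1) (m := m)
  (h := (m + d.+1 + m - 1)./2).
move=> /(_ ltac:(lia) ltac:(lia) ltac:(lia) ltac:(lia) ltac:(lia)) G.
have : central R (m + d.+1 + m - 1)./2 <= central R (maxn N d./2).
  by apply: central_decr; lia.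
have := central_ge0 R (maxn N d./2).
move=> c0 cc; rewrite /gram_bound /= ler_pdivlMr//; lra.
Qed.

(** The combination of the powers [phi2^(N+i)] with the common factor [T^N] removed, which is
    legitimate for upper bounds since [T] is a contraction. *)
Definition horner_seq L N b k := \sum_(i < L) b i * Tn i (c (N + i)) k.

Lemma horner_seqS L N b : horner_seq L.+1 N b =
  fun k => b 0%N * c N k + T (horner_seq L N.+1 (fun i => b i.+1)) k.
Proof.
apply/funext => k; rewrite /horner_seq big_ord_recl addn0; congr (_ + _).
have := linop_sum L (fun i => b i.+1) (fun i => Tn i (c (N.+1 + i))) linT.
by move=> ->; apply: eq_bigr => i _; rewrite -addSnnS.
Qed.

(* Each Horner step [y' = b c_N + T y] costs [|T y| <= |y|] and a cross term made of
   Gram entries. *)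
Lemma horner_seq_le N0 s K L N b : (N0 <= N)%N -> (2 * (N + L) + 5 < K)%N ->
  (forall M, \sum_(1 <= d < M.+1) gram_bound N0 d <= s) ->
  dot_seq K (horner_seq L N b) (horner_seq L N b) <=
  \sum_(i < L) b i ^+ 2 * (gram_bound N0 0 + s + \sum_(1 <= d < i.+1) gram_bound N0 d).
Proof.
move=> N0N NK hs; elim: L N b N0N NK => [|L IH] N b N0N NK.
  rewrite [X in _ <= X]big_ord0 /dot_seq big1// => k _.
  by rewrite /horner_seq big_ord0 mul0r.
rewrite horner_seqS dot_sqD.
rewrite big_ord_recl /= big_geq// addr0.
have H1 : dot_seq K (fun k => b 0%N * c N k) (fun k => b 0%N * c N k) <= b 0%N ^+ 2 * central R N0.
  rewrite dotZl dotZr mulrA -expr2 ler_wpM2l ?sqr_ge0//.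
  by rewrite dot_binom; [exact: central_decr|lia].
have H2 : 2 * dot_seq K (T (horner_seq L N.+1 (fun i => b i.+1))) (fun k => b 0%N * c N k) <=
    b 0%N ^+ 2 * s + \sum_(i < L) b i.+1 ^+ 2 * gram_bound N0 i.+1.
  rewrite dotZr /horner_seq.
  have := linop_sum L (fun i => b i.+1) (fun i => Tn i (c (N.+1 + i))) linT => ->.
  have := dot_suml K L (fun i => b i.+1) (fun i => T (Tn i (c (N.+1 + i)))) (c N) => ->.
  rewrite !mulr_sumr.
  (* Schur's test: each cross term is split evenly between its two indices. [b 0] is charged a whole
     row, at most [s]; [b i.+1] is charged one entry per Horner step, which is why its weight in the
     claim grows with [i]. *)
  apply: le_trans (_ : \sum_(i < L) (b 0%N ^+ 2 + b i.+1 ^+ 2) * gram_bound N0 i.+1 <= _).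
    apply: ler_sum => i _; rewrite -iterS addSnnS.
    have := gram_le_bound (N := N0) (K := K) (m := N) (d := i.+1) N0N.
    move=> /(_ ltac:(have := ltn_ord i; lia)); set g := dot_seq _ _ _ => G.
    have gb0 := gram_bound_ge0 N0 i.+1.
    apply: le_trans (ler_norm _) _.
    rewrite !normrM (ger0_norm (ler0n _ 2)).
    have : `|b 0%N| * `|b i.+1| * 2 <= b 0%N ^+ 2 + b i.+1 ^+ 2.
      rewrite -(real_normK (num_real (b 0%N))) -(real_normK (num_real (b i.+1))).
      have := sqr_ge0 (`|b 0%N| - `|b i.+1|); rewrite sqrrB; lra.
    move=> AB; apply: le_trans (_ : (`|b 0%N| * `|b i.+1| * 2) * `|g| <= _); first by lra.
    by apply: ler_pM => //; rewrite !mulr_ge0.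
  under eq_bigr => i _ do rewrite mulrDl.
  rewrite big_split /= -mulr_sumr lerD2r ler_wpM2l ?sqr_ge0//.
  by apply: le_trans (hs L); rewrite big_add1 big_mkord.
have H3 := le_trans (contrT K _) (IH N.+1 (fun i => b i.+1) (leqW N0N) ltac:(lia)).
apply: le_trans (lerD (lerD H1 H2) H3) _.
rewrite -addrA -addrA -big_split /= addrA -mulrDr lerD2l.
apply: ler_sum => i _; rewrite /bump /= add1n -mulrDr ler_wpM2l ?sqr_ge0//.
rewrite [X in _ <= _ + X]big_nat_recr//=; lra.
Qed.

Lemma dotS_le K K' u : (K <= K')%N -> dot_seq K u u <= dot_seq K' u u.
Proof.
move/subnKC => <-; elim: (K' - K)%N => [|j IH]; first by rewrite addn0.
by rewrite addnS dotE0; apply: le_trans IH _; rewrite lerDl -expr2 sqr_ge0.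
Qed.

Lemma tail_small (e : R) : 0 < e -> exists N, forall K L b,
  dot_seq K (fun k => \sum_(i < L) b i * Tn (N + i) (c (N + i)) k)
        (fun k => \sum_(i < L) b i * Tn (N + i) (c (N + i)) k) <=
  e * \sum_(i < L) b i ^+ 2.
Proof.
move=> e0.
(* With [D = 2 q], these choices make [16 g_q] and [(8 q + 1) g_N] each at most [e / 6]. The row
   sums are then at most [e / 3 - g_N], and the total weight [g_N + 2 (e / 3 - g_N)] stays below
   [e]. *)
have [q qe] := @central_small (e / 96) ltac:(lra).
have [N Ne] := @central_small (e / (6 + 48 * q%:R)) ltac:(rewrite divr_gt0// ltr_pwDl// mulr_ge0//).
have p : 0 < 6 + 48 * q%:R :> R by rewrite ltr_pwDl// mulr_ge0.
move: Ne; rewrite ler_pdivlMr// => Ne.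
have hs M : \sum_(1 <= d < M.+1) gram_bound N d <= e / 3 - central R N.
  apply: le_trans (gram_bound_sum N q.*2 M) _; rewrite doubleK -mul2n natrM.
  have := central_ge0 R N; lra.
exists N => K L b.
have -> : (fun k => \sum_(i < L) b i * Tn (N + i) (c (N + i)) k) =
    Tn N (horner_seq L N b).
  have := linop_sum L b (fun i => Tn i (c (N + i))) (linop_iter N linT) => ->.
  by apply/funext => k; apply: eq_bigr => i _; rewrite iterD.
apply: le_trans (iter_contrT contrT _ _ _) _.
(* The Gram estimates require a cutoff beyond all degrees involved; truncated norms only grow with
   the cutoff. *)
apply: le_trans (dotS_le _ (leq_addr (2 * (N + L) + 6) K)) _.
apply: le_trans (horner_seq_le (N0 := N) (s := e / 3 - central R N) _ (leqnn N) _ hs) _.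
  by lia.
rewrite mulr_sumr; apply: ler_sum => i _; rewrite mulrC ler_wpM2r ?sqr_ge0//.
have := hs i; have := central_ge0 R N; rewrite [gram_bound N 0]/gram_bound; lra.
Qed.

End Contraction.
End GramSums.

(** * The semigroup of inner multipliers *)

Section InnerFlow.
Variable R : realType.
Implicit Types (y u v b : nat -> R) (t : R).

Lemma derive_le_variation (f df : R -> R) (C : R) :
  (forall t, is_derive t 1 f (df t)) -> (forall t, 0 <= t <= 1 -> `|df t| <= C) ->
  `|f 1 - f 0| <= C.
Proof.
move=> fd fC.
have cf : {within `[0, 1], continuous f}.
  by apply: derivable_within_continuous => x _; have [] := fd x.
have [x x01 ->] := MVT_segment ler01 (fun x _ => fd x) cf.
by rewrite subr0 mulr1 fC//; move: x01; rewrite in_itv.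
Qed.

Lemma derive_le0_decr (f df : R -> R) t : 0 <= t ->
  (forall t, is_derive t 1 f (df t)) -> (forall t, df t <= 0) -> f t <= f 0.
Proof.
move=> t0 fd f0.
have cf : {within `[0, t], continuous f}.
  by apply: derivable_within_continuous => x _; have [] := fd x.
have [x x0t E] := MVT_segment t0 (fun x _ => fd x) cf.
by rewrite -subr_le0 E subr0 mulr_le0_ge0.
Qed.

(* Coefficients of [exp (- t (1 + z) / (1 - z))] times the series [y]. *)
Definition flow t y k : R := inner_op (expR (- t)) t y k.

Definition flow_poly y k : {poly R} :=
  \poly_(j < k.+1) ((-2) ^+ j / j`!%:R * iter j psum y k).

Lemma flowE t y k : flow t y k = expR (- t) * (flow_poly y k).[t].
Proof.
rewrite /flow /inner_op horner_poly; congr (_ * _); apply: eq_bigr => j _.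
by rewrite /laguerre_coef exprMn_comm; [ring|exact: mulrC].
Qed.

(** Coefficient form of [d/dt exp (- 2 t A) = - 2 A exp (- 2 t A)] with [A = psum]. *)
Lemma deriv_flow_poly y k : (flow_poly y k)^`() = -2 *: \sum_(i < k) flow_poly y i.
Proof.
apply/polyP => i; rewrite coef_deriv coefZ coef_sum coef_poly ltnS.
have -> : \sum_(j < k) (flow_poly y j)`_i = (-2) ^+ i / i`!%:R * iter i.+1 psum y k.
  rewrite iterS {2}/psum mulr_sumr; apply: eq_bigr => j _.
  rewrite coef_poly ltnS; case: (leqP i j) => // ji.
  by rewrite iter_psum_lt// mulr0.
case: ltnP => ik; last by rewrite iter_psum_lt// !mulr0 mul0rn.
rewrite -mulr_natr factS natrM exprS; field.
by rewrite nat1r !pnatr_eq0 -lt0n fact_gt0.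
Qed.

(** The generator [- (1 + z) / (1 - z)] written as [- (1 + 2 A)]. *)
Lemma is_derive_flow y k t :
  is_derive t 1 (fun s => flow s y k) (- (flow t y k + 2 * psum (flow t y) k)).
Proof.
rewrite (_ : (fun s => _) = (expR \o -%R) * horner (flow_poly y k)); last first.
  by apply/funext => s; rewrite flowE.
apply: is_derive_eq; rewrite deriv_flow_poly hornerZ horner_sum !flowE /GRing.scale /=.
rewrite /psum; under [in RHS]eq_bigr => i _ do rewrite flowE.
rewrite -mulr_sumr; ring.
Qed.

Lemma flow0 y k : flow 0 y k = y k.
Proof.
rewrite flowE oppr0 expR0 mul1r horner_coef0 coef_poly /= expr0 fact0 /=.
by rewrite divr1 mul1r.
Qed.

(** Telescoping of squared partial sums. This is the truncated form of the positivity of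
    [Re ((1 + z) / (1 - z))]: the quadratic form of the generator is minus a perfect square. *)
Lemma psum_sq y K : psum y K ^+ 2 = \sum_(k < K) (y k ^+ 2 + 2 * (y k * psum y k)).
Proof.
elim: K => [|K IH]; first by rewrite psum0 big_ord0 expr0n.
rewrite psumS big_ord_recr /= -IH; ring.
Qed.

(* [d/dt |U_t y|_K^2 = - 2 (sum of the first K coefficients of U_t y)^2]. *)
Lemma flow_contr K y t : 0 <= t -> dot_seq K (flow t y) (flow t y) <= dot_seq K y y.
Proof.
move=> t0; pose f t := dot_seq K (flow t y) (flow t y).
suff : f t <= f 0.
  rewrite /f /dot_seq => h; apply: le_trans h _.
  by apply: ler_sum => k _; rewrite flow0.
apply: (@derive_le0_decr f (fun t => - 2 * psum (flow t y) K ^+ 2)) => // {t0}t; last first.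
  by rewrite mulNr oppr_le0 mulr_ge0// sqr_ge0.
rewrite (_ : f = \sum_(k < K) (fun s => flow s y k) ^+ 2); last first.
  by apply/funext => s; rewrite fct_sumE; apply: eq_bigr => k _; rewrite exprfctE.
have D k : is_derive t 1 ((fun s => flow s y k) ^+ 2)
   (2%:R * (flow t y k ^+ 1) *: (- (flow t y k + 2 * psum (flow t y) k))).
  have := is_derive_flow y k t => ?.
  apply: is_derive_eq; rewrite /GRing.scale /=; ring.
apply: is_derive_eq; rewrite psum_sq mulr_sumr; apply: eq_bigr => k _.
rewrite /GRing.scale /=; ring.
Qed.

End InnerFlow.

(** * Power series in the disc *)

Section ComplexModulus.
Variable R : realType.
Implicit Types (z w : R[i]).

Lemma cabsE z : cabs z = Normc.normc z. Proof. by case: z. Qed.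

Lemma cabs_ge0 z : 0 <= cabs z. Proof. exact: sqrtr_ge0. Qed.

Lemma cabs_sq z : cabs z ^+ 2 = complex.Re z ^+ 2 + complex.Im z ^+ 2.
Proof. by rewrite sqr_sqrtr// addr_ge0// sqr_ge0. Qed.

Lemma cabs0 : cabs (0 : R[i]) = 0.
Proof. by rewrite cabsE Normc.normc0. Qed.

Lemma cabsM z w : cabs (z * w) = cabs z * cabs w.
Proof. by rewrite !cabsE Normc.normcM. Qed.

Lemma cabsX z n : cabs (z ^+ n) = cabs z ^+ n.
Proof. by elim: n => [|n IH]; rewrite ?expr0 ?cabsE ?Normc.normc1// !exprS -!cabsE cabsM IH. Qed.

Lemma cabsV z : cabs z^-1 = (cabs z)^-1.
Proof. by rewrite !cabsE Normc.normcV. Qed.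

Lemma cabsN z : cabs (- z) = cabs z.
Proof. by case: z => a b; rewrite /cabs /= !sqrrN. Qed.

Lemma cabsD z w : cabs (z + w) <= cabs z + cabs w.
Proof. by rewrite !cabsE le_normcD. Qed.

Lemma cabsB z w : cabs (z - w) <= cabs z + cabs w.
Proof. by rewrite -(cabsN w) cabsD. Qed.

Lemma cabs_real (a : R) : cabs a%:C%C = `|a|.
Proof. by rewrite /cabs /= expr0n addr0 sqrtr_sqr. Qed.

Lemma Re_le_cabs z : `|complex.Re z| <= cabs z.
Proof.
rewrite -(ler_pXn2r (n := 2)) ?nnegrE ?cabs_ge0//.
by rewrite cabs_sq real_normK ?num_real// lerDl sqr_ge0.
Qed.

Lemma Im_le_cabs z : `|complex.Im z| <= cabs z.
Proof.
rewrite -(ler_pXn2r (n := 2)) ?nnegrE ?cabs_ge0//.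
by rewrite cabs_sq real_normK ?num_real// lerDr sqr_ge0.
Qed.

Lemma cabs_le_ReIm z : cabs z <= `|complex.Re z| + `|complex.Im z|.
Proof.
rewrite -(ler_pXn2r (n := 2)) ?nnegrE ?cabs_ge0 ?addr_ge0//.
rewrite cabs_sq sqrrD !real_normK ?num_real//.
by rewrite -addrA lerD2l lerDr mulrn_wge0// mulr_ge0.
Qed.

Lemma cabs_eq0 z : cabs z = 0 -> z = 0.
Proof. by rewrite cabsE => /Normc.eq0_normc. Qed.

Lemma cabs_sum (I : Type) (r : seq I) (P : pred I) (F : I -> R[i]) :
  cabs (\sum_(i <- r | P i) F i) <= \sum_(i <- r | P i) cabs (F i).
Proof.
elim/big_ind2 : _ => [|z1 x1 z2 x2 h1 h2|//]; first by rewrite cabs0.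
exact: le_trans (cabsD _ _) (lerD h1 h2).
Qed.

Lemma ReD z w : complex.Re (z + w) = complex.Re z + complex.Re w.
Proof. by case: z w => [? ?] [? ?]. Qed.

Lemma ImD z w : complex.Im (z + w) = complex.Im z + complex.Im w.
Proof. by case: z w => [? ?] [? ?]. Qed.

Lemma Re_sum (I : Type) (r : seq I) (P : pred I) (F : I -> R[i]) :
  complex.Re (\sum_(i <- r | P i) F i) = \sum_(i <- r | P i) complex.Re (F i).
Proof. exact: (big_morph _ ReD (erefl _)). Qed.

Lemma Im_sum (I : Type) (r : seq I) (P : pred I) (F : I -> R[i]) :
  complex.Im (\sum_(i <- r | P i) F i) = \sum_(i <- r | P i) complex.Im (F i).
Proof. exact: (big_morph _ ImD (erefl _)). Qed.

Lemma ReZ (a : R) z : complex.Re (a%:C%C * z) = a * complex.Re z.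
Proof. by case: z => x y /=; rewrite mul0r subr0. Qed.

Lemma ImZ (a : R) z : complex.Im (a%:C%C * z) = a * complex.Im z.
Proof. by case: z => x y /=; rewrite mul0r addr0. Qed.

Definition ctends (u : nat -> R[i]) (l : R[i]) :=
  (fun n => cabs (u n - l)) @ \oo --> (0 : R).

Lemma ctends_bound (b : nat -> R) u l :
  (forall n, cabs (u n - l) <= b n) -> b @ \oo --> (0 : R) -> ctends u l.
Proof.
move=> ub b0; apply: (@squeeze_cvgr _ _ _ _ (cst 0) b) => //; last exact: cvg_cst.
by apply: nearW => n; rewrite cabs_ge0 ub.
Qed.

Lemma ctendsD u v l m : ctends u l -> ctends v m ->
  ctends (fun n => u n + v n) (l + m).
Proof.
move=> ul vm; apply: (@ctends_bound (fun n => cabs (u n - l) + cabs (v n - m))).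
  by move=> n; rewrite opprD addrACA cabsD.
by rewrite -[X in _ --> X](addr0 0); exact: cvgD.
Qed.

Lemma ctendsMl a u l : ctends u l -> ctends (fun n => a * u n) (a * l).
Proof.
move=> ul; apply: (@ctends_bound (fun n => cabs a * cabs (u n - l))).
  by move=> n; rewrite -mulrBr cabsM.
by rewrite -[X in _ --> X](mulr0 (cabs a)); exact: cvgMr.
Qed.

Lemma ctends_near u v l : ctends u l -> ctends (fun n => v n - u n) 0 -> ctends v l.
Proof.
move=> ul vu; have := ctendsD vu ul.
rewrite add0r (_ : (fun n => _ + _) = v)//; apply/funext => n; by rewrite subrK.
Qed.

Lemma cvg_expr0 (r : R) : 0 <= r < 1 -> (fun n => r ^+ n) @ \oo --> (0 : R).
Proof. by move=> /andP[r0 r1]; apply: cvg_expr; rewrite ger0_norm. Qed.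

(** With [r = s^2], the factor [n s^n] is bounded by comparison with the geometric sum, and the
    other factor [s^n] tends to 0. *)
Lemma cvg_n_expr0 (r : R) : 0 <= r < 1 -> (fun n => n%:R * r ^+ n) @ \oo --> (0 : R).
Proof.
move=> /andP[r0 r1]; pose s := Num.sqrt r.
have s0 : 0 <= s by exact: sqrtr_ge0.
have s1 : s < 1 by rewrite -sqrtr1 ltr_sqrt.
have rs : r = s * s by rewrite -expr2 sqr_sqrtr.
have ns n : n%:R * s ^+ n <= (1 - s)^-1.
  have p : 0 < 1 - s by rewrite subr_gt0.
  rewrite -[_^-1]mul1r ler_pdivlMr//.
  have : n%:R * s ^+ n * (1 - s) <= 1 - s ^+ n.
    elim: n => [|n IH]; first by rewrite mul0r mul0r expr0 subrr.
    have sn0 : 0 <= s ^+ n by rewrite exprn_ge0.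
    rewrite exprS -natr1.
    have : s * (n%:R * s ^+ n * (1 - s)) <= s * (1 - s ^+ n) by rewrite ler_wpM2l.
    have : 0 <= (1 - s) * (1 - s * s ^+ n); last by nra.
    apply: mulr_ge0; first exact: ltW.
    by rewrite subr_ge0 -exprS; apply: exprn_ile1 => //; exact: ltW.
  by have := exprn_ge0 n s0; lra.
apply: (@squeeze_cvgr _ _ _ _ (cst 0) (fun n => (1 - s)^-1 * s ^+ n)).
- apply: nearW => n /=; rewrite mulr_ge0 ?exprn_ge0//=.
  by rewrite rs exprMn mulrA ler_wpM2r ?exprn_ge0.
- exact: cvg_cst.
- rewrite -[X in _ --> X](mulr0 (1 - s)^-1); apply: cvgMr; apply: cvg_expr0.
  by rewrite s0.
Qed.


Lemma cabs_pos_1B z : cabs z < 1 -> 1 - z != 0.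
Proof.
move=> z1; apply/eqP => /eqP; rewrite subr_eq0 => /eqP zE.
by move: z1; rewrite -zE cabsE Normc.normc1 ltxx.
Qed.

Definition powser (a : nat -> R[i]) z (N : nat) : R[i] := \sum_(n < N) a n * z ^+ n.
Definition cseq (y : nat -> R) n : R[i] := (y n)%:C%C.

Lemma powserS a z N : powser a z N.+1 = powser a z N + a N * z ^+ N.
Proof. by rewrite /powser big_ord_recr. Qed.

Lemma powser_shift y z N :
  powser (cseq (shift_seq y)) z N = z * powser (cseq y) z N - cseq (shift_seq y) N * z ^+ N.
Proof.
elim: N => [|N IH]; first by rewrite /powser !big_ord0 /cseq /= mul0r mulr0 subr0.
by rewrite !powserS IH /cseq /= exprS; ring.
Qed.

Lemma powser_psum y z N : (1 - z) * powser (cseq (psum y)) z N =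
  z * powser (cseq y) z N - cseq (psum y) N * z ^+ N.
Proof.
elim: N => [|N IH].
  by rewrite /powser !big_ord0 /cseq psum0 !mulr0 mul0r subr0.
by rewrite !powserS mulrDr IH /cseq psumS rmorphD exprS; ring.
Qed.

Definition l2_le (B : R) (y : nat -> R) := forall K, dot_seq K y y <= B.

Lemma l2_le_coef B y k : l2_le B y -> `|y k| <= 1 + B.
Proof.
move=> yB; have := yB k.+1; rewrite dotE0 -expr2 -real_normK ?num_real// => h.
have := dot_ge0 k y; have := sqr_ge0 (`|y k| - 1); rewrite sqrrB1.
have := normr_ge0 (y k); nra.
Qed.

Lemma l2_le_ge0 B y : l2_le B y -> 0 <= B.
Proof. by move=> /(_ 0%N); rewrite /dot_seq big_ord0. Qed.

Lemma l2_le_psum B y N : l2_le B y -> `|psum y N| <= N%:R + B.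
Proof.
move=> yB; apply: le_trans (_ : N%:R + dot_seq N y y <= _); last by rewrite lerD2l.
apply: le_trans (ler_norm_sum _ _ _) _.
rewrite -[N in N%:R]card_ord -sumr_const -big_split /=; apply: ler_sum => k _.
rewrite -expr2 -real_normK ?num_real//.
by have := sqr_ge0 (`|y k| - 1); have := normr_ge0 (y k); rewrite sqrrB1; nra.
Qed.

Lemma half_shift_eval B y z Y : cabs z < 1 -> l2_le B y ->
  ctends (powser (cseq y) z) Y ->
  ctends (powser (cseq (half_shift y)) z) ((1 + z) / 2 * Y).
Proof.
move=> z1 yB yY; apply: (ctends_near (ctendsMl ((1 + z) / 2) yY)).
apply: (@ctends_bound (fun n => (1 + B) * cabs z ^+ n)) => [n|]; last first.
  rewrite -[X in _ --> X](mulr0 (1 + B)); apply: cvgMr; apply: cvg_expr0.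
  by rewrite cabs_ge0.
have -> : powser (cseq (half_shift y)) z n =
   2^-1 * (powser (cseq y) z n + powser (cseq (shift_seq y)) z n).
  rewrite /powser -big_split mulr_sumr; apply: eq_bigr => k _ /=.
  rewrite /cseq /half_shift mulrC rmorphM rmorphD fmorphV rmorph_nat; ring.
rewrite powser_shift.
rewrite (_ : _ - 0 = - (2^-1 * (cseq (shift_seq y) n * z ^+ n))); last by ring.
have B0 := l2_le_ge0 yB.
rewrite cabsN !cabsM cabsX cabs_real.
have -> : cabs (2^-1 : R[i]) = 2^-1.
  rewrite (_ : 2^-1 = (2^-1)%:C%C); last by rewrite fmorphV rmorph_nat.
  by rewrite cabs_real ger0_norm// invr_ge0.
rewrite mulrA ler_wpM2r ?exprn_ge0 ?cabs_ge0//.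
have : `|shift_seq y n| <= 1 + B.
  by case: n => [|n] /=; [rewrite normr0; lra|exact: l2_le_coef].
have := normr_ge0 (shift_seq y n); lra.
Qed.

End ComplexModulus.

(** * The function [S] and its agreement with the flow at points of the disc *)

Section InnerFunction.
Variable R : realType.
Implicit Types (z w : R[i]) (y : nat -> R) (t : R).

Definition den z : R := (1 - complex.Re z) ^+ 2 + complex.Im z ^+ 2.
Definition inner_re z : R := - ((1 - complex.Re z ^+ 2 - complex.Im z ^+ 2) / den z).
Definition inner_im z : R := - (2 * complex.Im z / den z).

(* [exp (- (1 + z) / (1 - z))]; the exponent has real part [inner_re z]
   and imaginary part [inner_im z]. *)
Definition inner_fun z : R[i] := Complex (expR (inner_re z) * cos (inner_im z))
                                         (expR (inner_re z) * sin (inner_im z)).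

Lemma den_gt0 z : cabs z < 1 -> 0 < den z.
Proof.
move=> z1; have := cabs_sq z; have := cabs_ge0 z; have := Re_le_cabs z.
rewrite ler_norml /den => /andP[_ h] _ _.
have : 0 < (1 - complex.Re z) ^+ 2 by rewrite exprn_gt0//; lra.
have := sqr_ge0 (complex.Im z); lra.
Qed.

Lemma inner_re_le0 z : cabs z < 1 -> inner_re z <= 0.
Proof.
move=> z1; rewrite oppr_le0; apply: divr_ge0; last exact/ltW/den_gt0.
have : cabs z ^+ 2 <= 1 by apply: exprn_ile1; rewrite ?cabs_ge0// ltW.
rewrite cabs_sq; lra.
Qed.

Lemma cabs_inner z : cabs (inner_fun z) = expR (inner_re z).
Proof.
by rewrite /cabs /= !exprMn -mulrDr cos2Dsin2 mulr1 sqrtr_sqr ger0_norm//.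
Qed.

Lemma cabs_inner_le1 z : cabs z < 1 -> cabs (inner_fun z) <= 1.
Proof. by move=> z1; rewrite cabs_inner -expR0 ler_expR inner_re_le0. Qed.

Lemma inner_exponent z : cabs z < 1 ->
  Complex (inner_re z) (inner_im z) * (1 - z) = - (1 + z).
Proof.
move=> /den_gt0/lt0r_neq0; rewrite /inner_re /inner_im; case: z => a b /=.
rewrite /den /= => d; apply/eqP; rewrite eq_complex /=.
by apply/andP; split; apply/eqP; field.
Qed.

Lemma is_derive_wsum (a : nat -> R) y N t :
  is_derive t 1 (fun s => \sum_(k < N) flow s y k * a k)
    (\sum_(k < N) - (flow t y k + 2 * psum (flow t y) k) * a k).
Proof.
rewrite (_ : (fun s => _) = \sum_(k < N) (fun s => flow s y k) * cst (a k)); last first.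
  by apply/funext => s; rewrite fct_sumE.
have D (k : 'I_N) := is_derive_flow y k t.
apply: is_derive_eq; apply: eq_bigr => k _.
rewrite /GRing.scale /=; ring.
Qed.

(* The truncated series solves [F' = w F + rho] with [w = - (1 + z) / (1 - z)] and
   [rho] of order [N z^N]. *)
Lemma flow_powser_eq y z N t : cabs z < 1 ->
  powser (cseq (fun k => - (flow t y k + 2 * psum (flow t y) k))) z N =
  Complex (inner_re z) (inner_im z) * powser (cseq (flow t y)) z N
  + 2 * (cseq (psum (flow t y)) N * z ^+ N) / (1 - z).
Proof.
move=> z1; have z10 := cabs_pos_1B z1.
apply: (mulIf z10); rewrite [RHS]mulrDl divfK// mulrAC inner_exponent//.
have -> : powser (cseq (fun k => - (flow t y k + 2 * psum (flow t y) k))) z N =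
    - (powser (cseq (flow t y)) z N + 2 * powser (cseq (psum (flow t y))) z N).
  rewrite /powser mulr_sumr -big_split -sumrN; apply: eq_bigr => k _ /=.
  rewrite /cseq (_ : 2 * psum _ _ = psum (flow t y) k + psum (flow t y) k); last by ring.
  rewrite rmorphN !rmorphD; ring.
rewrite mulNr mulrDl -mulrA [_ * (1 - z)]mulrC (mulrC _ (1 - z)) powser_psum; ring.
Qed.

Lemma Re_powser (y : nat -> R) z N :
  complex.Re (powser (cseq y) z N) = \sum_(k < N) y k * complex.Re (z ^+ k).
Proof. by rewrite Re_sum; apply: eq_bigr => k _; rewrite ReZ. Qed.

Lemma Im_powser (y : nat -> R) z N :
  complex.Im (powser (cseq y) z N) = \sum_(k < N) y k * complex.Im (z ^+ k).
Proof. by rewrite Im_sum; apply: eq_bigr => k _; rewrite ImZ. Qed.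

Lemma is_derive_scale (v t : R) : is_derive t 1 (fun s : R => v * s) v.
Proof.
rewrite (_ : (fun s => _) = cst v * id); last by [].
apply: is_derive_eq; rewrite /GRing.scale /=; ring.
Qed.

(** Variation of constants for [F' = w F + rho] on [[0, 1]], [w = u + i v]. If [|rho| <= M], each
    component of [exp (- w t) F] varies by at most [2 M exp (- u)]; multiplying back by
    [inner_fun z], of modulus [exp u], leaves [4 M], whence the 8. *)
Lemma flow_eval_bound B y z N : cabs z < 1 -> l2_le B y ->
  cabs (powser (cseq (flow 1 y)) z N - inner_fun z * powser (cseq y) z N) <=
  8 / cabs (1 - z) * ((N%:R + B) * cabs z ^+ N).
Proof.
move=> z1 yB; set u := inner_re z; set v := inner_im z.
pose X t := complex.Re (powser (cseq (flow t y)) z N).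
pose Y t := complex.Im (powser (cseq (flow t y)) z N).
pose rho t : R[i] := 2 * (cseq (psum (flow t y)) N * z ^+ N) / (1 - z).
have FE s : powser (cseq (flow s y)) z N = Complex (X s) (Y s).
  by rewrite /X /Y; case: (powser _ _ _).
have dX t : is_derive t 1 X (u * X t - v * Y t + complex.Re (rho t)).
  have XE : X = fun s => \sum_(k < N) flow s y k * complex.Re (z ^+ k).
    by apply/funext => s; rewrite /X Re_powser.
  have := is_derive_wsum (fun k => complex.Re (z ^+ k)) y N t.
  rewrite -(Re_powser (fun k => - (flow t y k + 2 * psum (flow t y) k))) -XE.
  by rewrite flow_powser_eq// FE ReD.
have dY t : is_derive t 1 Y (v * X t + u * Y t + complex.Im (rho t)).
  have YE : Y = fun s => \sum_(k < N) flow s y k * complex.Im (z ^+ k).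
    by apply/funext => s; rewrite /Y Im_powser.
  have := is_derive_wsum (fun k => complex.Im (z ^+ k)) y N t.
  rewrite -(Im_powser (fun k => - (flow t y k + 2 * psum (flow t y) k))) -YE.
  by rewrite flow_powser_eq// FE ImD /= (addrC (u * Y t)).
pose E t := expR (- u * t).
have dE t : is_derive t 1 E (- u * E t).
  have ? := is_derive_scale (- u) t.
  rewrite (_ : E = expR \o (fun s => - u * s))//; apply: is_derive_eq.
  by rewrite mulrC.
have dC t : is_derive t 1 (fun s => cos (v * s)) (- (v * sin (v * t))).
  have ? := is_derive_scale v t.
  rewrite (_ : (fun s => _) = cos \o (fun s => v * s))//; apply: is_derive_eq.
  by rewrite mulNr mulrC.
have dS t : is_derive t 1 (fun s => sin (v * s)) (v * cos (v * t)).
  have ? := is_derive_scale v t.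
  rewrite (_ : (fun s => _) = sin \o (fun s => v * s))//; apply: is_derive_eq.
  by rewrite mulrC.
(* [Q1] and [Q2] are the real and imaginary parts of [exp (- w t) F], kept apart because the mean
   value theorem is applied to real functions. *)
pose Q1 : R -> R := E * ((fun s => cos (v * s)) * X + (fun s => sin (v * s)) * Y).
pose Q2 : R -> R := E * ((fun s => cos (v * s)) * Y - (fun s => sin (v * s)) * X).
have dQ1 t : is_derive t 1 Q1
    (E t * (cos (v * t) * complex.Re (rho t) + sin (v * t) * complex.Im (rho t))).
  apply: is_derive_eq; rewrite /GRing.scale !fctE /=; ring.
have dQ2 t : is_derive t 1 Q2
    (E t * (cos (v * t) * complex.Im (rho t) - sin (v * t) * complex.Re (rho t))).
  apply: is_derive_eq; rewrite /GRing.scale !fctE /=; ring.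
have u0 : u <= 0 by exact: inner_re_le0.
have cz : 0 < cabs (1 - z).
  rewrite lt_neqAle cabs_ge0 andbT eq_sym; apply/eqP => /cabs_eq0/eqP.
  by rewrite (negPf (cabs_pos_1B z1)).
pose M := 2 / cabs (1 - z) * ((N%:R + B) * cabs z ^+ N).
have rhoM t : 0 <= t -> cabs (rho t) <= M.
  move=> t0; rewrite /rho !cabsM cabsV cabsX cabs_real /M.
  have -> : cabs (2 : R[i]) = 2.
    rewrite (_ : 2 = 2%:C%C); last by rewrite rmorph_nat.
    by rewrite cabs_real ger0_norm.
  rewrite (mulrAC 2) ler_wpM2l ?divr_ge0 ?cabs_ge0// ler_wpM2r ?exprn_ge0 ?cabs_ge0//.
  by apply: l2_le_psum => K; apply: le_trans (flow_contr K y t0) (yB K).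
have EM t : 0 <= t <= 1 -> 0 <= E t <= expR (- u).
  by move=> /andP[t0 t1]; rewrite expR_ge0 ler_expR; nra.
have bnd t (a b : R) : 0 <= t <= 1 -> `|a| <= cabs (rho t) -> `|b| <= cabs (rho t) ->
   `|E t * (cos (v * t) * a + sin (v * t) * b)| <= expR (- u) * (2 * M).
  move=> t01 aM bM; have /andP[E0 E1] := EM t t01; have /andP[t0 _] := t01.
  rewrite normrM (ger0_norm E0); apply: ler_pM => //.
  apply: le_trans (ler_normD _ _) _; rewrite !normrM.
  have c1 : `|cos (v * t)| <= 1 by rewrite ler_norml cos_geN1 cos_le1.
  have s1 : `|sin (v * t)| <= 1 by rewrite ler_norml sin_geN1 sin_le1.
  have rM := rhoM t t0.
  have := ler_pM (normr_ge0 _) (normr_ge0 a) c1 (le_trans aM rM).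
  have := ler_pM (normr_ge0 _) (normr_ge0 b) s1 (le_trans bM rM); lra.
have V1 : `|Q1 1 - Q1 0| <= expR (- u) * (2 * M).
  apply: (derive_le_variation dQ1) => t t01; apply: bnd => //.
  - exact: Re_le_cabs.
  - exact: Im_le_cabs.
have V2 : `|Q2 1 - Q2 0| <= expR (- u) * (2 * M).
  apply: (derive_le_variation dQ2) => t t01; rewrite -mulrN; apply: bnd => //.
  - exact: Im_le_cabs.
  - by rewrite normrN; exact: Re_le_cabs.
have F0 : powser (cseq y) z N = Complex (X 0) (Y 0).
  by rewrite -FE (_ : flow 0 y = y)//; apply/funext => k; rewrite flow0.
have -> : powser (cseq (flow 1 y)) z N - inner_fun z * powser (cseq y) z N =
    inner_fun z * Complex (Q1 1 - Q1 0) (Q2 1 - Q2 0).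
  rewrite F0 FE /inner_fun -/u -/v /Q1 /Q2 !fctE /E !mulr1 !mulr0 expR0 cos0 sin0.
  have eu : expR u * expR (- u) = 1 by rewrite -expRD subrr expR0.
  have cs := cos2Dsin2 v.
  apply/eqP; rewrite eq_complex /=; apply/andP; split; apply/eqP.
  - apply: subr0_eq; transitivity
      (X 1 * (1 - expR u * expR (- u) * (cos v ^+ 2 + sin v ^+ 2))); first by ring.
    by rewrite eu cs; ring.
  - apply: subr0_eq; transitivity
      (Y 1 * (1 - expR u * expR (- u) * (cos v ^+ 2 + sin v ^+ 2))); first by ring.
    by rewrite eu cs; ring.
rewrite cabsM cabs_inner -/u.
have eu : expR u * expR (- u) = 1 by rewrite -expRD subrr expR0.
apply: le_trans (_ : expR u * (expR (- u) * (2 * M) + expR (- u) * (2 * M)) <= _).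
  rewrite ler_wpM2l ?expR_ge0//; apply: le_trans (cabs_le_ReIm _) _.
  exact: lerD.
rewrite -mulrDl mulrA mulrDr eu /M; lra.
Qed.

Lemma flow_eval B y z Y : cabs z < 1 -> l2_le B y -> ctends (powser (cseq y) z) Y ->
  ctends (powser (cseq (flow 1 y)) z) (inner_fun z * Y).
Proof.
move=> z1 yB yY; apply: (ctends_near (ctendsMl (inner_fun z) yY)).
apply: (@ctends_bound _ (fun N => 8 / cabs (1 - z) * ((N%:R + B) * cabs z ^+ N))) => [n|].
  by rewrite subr0 flow_eval_bound.
rewrite -[X in _ --> X](mulr0 (8 / cabs (1 - z))); apply: cvgMr.
rewrite (_ : (fun N => _) = (fun n => n%:R * cabs z ^+ n + B * cabs z ^+ n)); last first.
  by apply/funext => n; rewrite mulrDl.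
have z01 : 0 <= cabs z < 1 by rewrite cabs_ge0.
rewrite -[X in _ --> X](addr0 0); apply: cvgD; first exact: cvg_n_expr0.
by rewrite -[X in _ --> X](mulr0 B); apply: cvgMr; exact: cvg_expr0.
Qed.

End InnerFunction.

(** * The Hardy norm *)

Section HardyNorm.
Variable R : realType.
Implicit Types (z w : R[i]) (a c : nat -> R[i]) (x : nat -> R).

Definition csq a K : R := \sum_(k < K) cabs (a k) ^+ 2.

Lemma csq_ge0 a K : 0 <= csq a K.
Proof. by apply: sumr_ge0 => k _; rewrite sqr_ge0. Qed.

Lemma csqE a K : csq a K = dot_seq K (fun k => complex.Re (a k)) (fun k => complex.Re (a k))
  + dot_seq K (fun k => complex.Im (a k)) (fun k => complex.Im (a k)).
Proof. by rewrite /dot_seq -big_split; apply: eq_bigr => k _; rewrite cabs_sq !expr2. Qed.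

Lemma cabs_sqD_le z w : cabs (z + w) ^+ 2 <= 2 * cabs z ^+ 2 + 2 * cabs w ^+ 2.
Proof.
apply: le_trans (_ : (cabs z + cabs w) ^+ 2 <= _).
  by rewrite ler_pXn2r ?nnegrE ?addr_ge0 ?cabs_ge0// cabsD.
by have := sqr_ge0 (cabs z - cabs w); nra.
Qed.

Lemma csqD_le a c K : csq (fun k => a k + c k) K <= 2 * csq a K + 2 * csq c K.
Proof. by rewrite /csq !mulr_sumr -big_split; apply: ler_sum => k _; exact: cabs_sqD_le. Qed.

Lemma csqN a K : csq (fun k => - a k) K = csq a K.
Proof. by apply: eq_bigr => k _; rewrite cabsN. Qed.

Lemma csq_mono a K L : (K <= L)%N -> csq a K <= csq a L.
Proof.
move/subnKC => <-; rewrite /csq big_split_ord lerDl.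
by apply: sumr_ge0 => k _; rewrite sqr_ge0.
Qed.

(** Passage from the extended-real series in [H2_norm_le] to uniform bounds on finite sums, the form
    used in all estimates. *)
Lemma nneseries_leP x (r : R) : (forall n, 0 <= x n) ->
  ((\sum_(0 <= n <oo) (x n)%:E <= r%:E)%E <-> forall K, \sum_(n < K) x n <= r).
Proof.
move=> x0; split=> [h K|h].
  rewrite -lee_fin; apply: le_trans h.
  apply: le_trans (nneseries_lim_ge (P := xpredT) (m := 0) K _); last first.
    by move=> n _ _; rewrite lee_fin.
  by rewrite big_mkord sumEFin.
apply: lime_le; first by apply: is_cvg_nneseries => n _ _; rewrite lee_fin.
by apply: nearW => K; rewrite big_mkord sumEFin lee_fin.
Qed.

Lemma H2_norm_leP (f : R[i] -> R[i]) (r : R) : H2_norm_le f r <->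
  0 <= r /\ exists a, taylor_on_disc f a /\ forall K, csq a K <= r ^+ 2.
Proof.
have P a := nneseries_leP (r ^+ 2) (fun n => sqr_ge0 (cabs (a n))).
split=> -[r0 [a [fa ar]]]; split=> //; exists a; split=> //; exact/P.
Qed.

Lemma taylor_on_discE (f : R[i] -> R[i]) a :
  taylor_on_disc f a <-> forall z, cabs z < 1 -> ctends (powser a z) (f z).
Proof. by split=> h z z1; apply: h; move: z1; rewrite inE. Qed.

Lemma sum_CauchySchwarz n (u v : nat -> R) :
  (\sum_(i < n) u i * v i) ^+ 2 <= (\sum_(i < n) u i ^+ 2) * (\sum_(i < n) v i ^+ 2).
Proof.
elim: n => [|n IH]; first by rewrite !big_ord0 expr0n mul0r.
rewrite !big_ord_recr /=; set A := \sum_(i < n) _; set U := \sum_(i < n) _.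
set V := \sum_(i < n) _; move: IH; rewrite -/A -/U -/V => IH.
have U0 : 0 <= U by apply: sumr_ge0 => i _; rewrite sqr_ge0.
have V0 : 0 <= V by apply: sumr_ge0 => i _; rewrite sqr_ge0.
suff : 2 * (A * (u n * v n)) <= U * v n ^+ 2 + V * u n ^+ 2 by move: IH; lra.
have W0 : 0 <= U * v n ^+ 2 + V * u n ^+ 2 by rewrite addr_ge0// mulr_ge0// sqr_ge0.
apply: le_trans (ler_norm _) _; rewrite -(ler_pXn2r (n := 2)) ?nnegrE//.
rewrite real_normK ?num_real//.
apply: le_trans (_ : 4 * (U * V) * (u n * v n) ^+ 2 <= _).
  rewrite (_ : (2 * _) ^+ 2 = 4 * A ^+ 2 * (u n * v n) ^+ 2); last by ring.
  by rewrite ler_wpM2r ?sqr_ge0// ler_wpM2l.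
have := sqr_ge0 (U * v n ^+ 2 - V * u n ^+ 2); nra.
Qed.

(** Cauchy-Schwarz against the geometric sequence; [1 / (1 - |z|^2)] is the squared norm of the
    reproducing kernel at [z]. *)
Lemma powser_bound a z N : cabs z < 1 ->
  cabs (powser a z N) ^+ 2 * (1 - cabs z ^+ 2) <= csq a N.
Proof.
move=> z1; have z0 := cabs_ge0 z; set r := cabs z.
have r2 : 0 < 1 - r ^+ 2 by rewrite subr_gt0 exprn_ilt1.
have geo : (\sum_(k < N) (r ^+ k) ^+ 2) * (1 - r ^+ 2) <= 1.
  elim: N => [|N IH]; first by rewrite big_ord0 mul0r.
  suff : (\sum_(k < N.+1) (r ^+ k) ^+ 2) * (1 - r ^+ 2) = 1 - (r ^+ N.+1) ^+ 2.
    by move=> ->; have := sqr_ge0 (r ^+ N.+1); lra.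
  elim: N.+1 => [|M IM]; first by rewrite big_ord0 mul0r expr0 expr1n subrr.
  rewrite big_ord_recr /= mulrDl IM (exprS r M); ring.
have C1 : cabs (powser a z N) ^+ 2 <= csq a N * \sum_(k < N) (r ^+ k) ^+ 2.
  apply: le_trans (sum_CauchySchwarz N (fun k => cabs (a k)) (fun k => r ^+ k)).
  have h : cabs (powser a z N) <= \sum_(k < N) cabs (a k) * r ^+ k.
    apply: le_trans (cabs_sum _ _ _) _; apply: ler_sum => k _.
    by rewrite cabsM cabsX.
  rewrite ler_pXn2r// nnegrE ?cabs_ge0//; exact: le_trans (cabs_ge0 _) h.
apply: le_trans (ler_wpM2r (ltW r2) C1) _.
by rewrite -mulrA -[leRHS]mulr1 ler_wpM2l ?csq_ge0.
Qed.

Lemma ctendsP (u : nat -> R[i]) l :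
  ctends u l <-> forall e : R, 0 < e -> \forall n \near \oo, cabs (u n - l) <= e.
Proof.
split=> [/cvgr0Pnorm_le h e e0|h].
  by have := h e e0; apply: filterS => n; rewrite ger0_norm ?cabs_ge0.
apply/cvgr0Pnorm_le => e e0; have := h e e0; apply: filterS => n.
by rewrite ger0_norm ?cabs_ge0.
Qed.

Lemma cvg_cabs (u : nat -> R[i]) l : ctends u l -> (fun n => cabs (u n)) @ \oo --> cabs l.
Proof.
move=> /ctendsP h; apply/cvgrPdist_le => e e0; have := h e e0.
apply: filterS => n; apply: le_trans; rewrite ler_norml.
have := cabsB (u n) (u n - l); rewrite subKr => h1.
have := cabsD l (u n - l); rewrite (addrC l) subrK => h2.
by apply/andP; split; lra.
Qed.

Lemma ctends_le (u : nat -> R[i]) l (A : R) :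
  ctends u l -> (\forall n \near \oo, cabs (u n) <= A) -> cabs l <= A.
Proof. by move=> /cvg_cabs ul h; apply: (cvgr_to_le ul). Qed.

Lemma csq_lim (u : nat -> nat -> R[i]) c K (A : R) :
  (forall k, ctends (u ^~ k) (c k)) -> (forall M, csq (u M) K <= A) -> csq c K <= A.
Proof.
move=> uc uA.
have : (fun M => csq (u M) K) @ \oo --> csq c K.
  elim: K {uA} => [|K IH].
    rewrite /csq big_ord0 (_ : (fun M => _) = cst 0); first exact: cvg_cst.
    by apply/funext => M; rewrite big_ord0.
  rewrite /csq big_ord_recr (_ : (fun M => _) = (fun M => csq (u M) K + cabs (u M K) ^+ 2)).
    apply: cvgD => //; rewrite (_ : (fun M => _) = (fun M => cabs (u M K) * cabs (u M K))).
      by rewrite expr2; apply: cvgM; exact: cvg_cabs.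
    by apply/funext => M; rewrite expr2.
  by apply/funext => M; rewrite /csq big_ord_recr.
by move=> h; apply: (cvgr_to_le h); exact: nearW.
Qed.

Lemma real_summable x (M : R) : (forall N, \sum_(n < N) `|x n| <= M) ->
  exists l : R, (fun N => \sum_(n < N) x n) @ \oo --> l.
Proof.
move=> xM.
have : cvgn [normed series x].
  apply: nondecreasing_is_cvgn.
    apply: nondecreasing_series => n _ _; exact: normr_ge0.
  by exists M => _ [N _ <-] /=; rewrite /series /= big_mkord.
move/normed_cvg => h; exists (limn (series x)).
rewrite (_ : (fun N => _) = series x)//.
by apply/funext => N; rewrite /series /= big_mkord.
Qed.

Lemma cvg_csum a (M : R) : (forall N, \sum_(n < N) cabs (a n) <= M) ->
  exists l, ctends (fun N => \sum_(n < N) a n) l.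
Proof.
move=> aM.
have [l1 h1] : exists l : R, (fun N => \sum_(n < N) complex.Re (a n)) @ \oo --> l.
  apply: (real_summable (x := fun n => complex.Re (a n)) (M := M)) => N; apply: le_trans (aM N).
  by apply: ler_sum => n _; exact: Re_le_cabs.
have [l2 h2] : exists l : R, (fun N => \sum_(n < N) complex.Im (a n)) @ \oo --> l.
  apply: (real_summable (x := fun n => complex.Im (a n)) (M := M)) => N; apply: le_trans (aM N).
  by apply: ler_sum => n _; exact: Im_le_cabs.
exists (Complex l1 l2).
apply: (@ctends_bound _ (fun N => `|\sum_(n < N) complex.Re (a n) - l1|
   + `|\sum_(n < N) complex.Im (a n) - l2|)) => [N|].
  apply: le_trans (cabs_le_ReIm _) _.
  by rewrite ReD ImD Re_sum Im_sum.
rewrite -[X in _ --> X](addr0 0); apply: cvgD.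
- by move/subr_cvg0 : h1 => /cvg_norm; rewrite normr0.
- by move/subr_cvg0 : h2 => /cvg_norm; rewrite normr0.
Qed.

Lemma csq_tail a (A e : R) : (forall K, csq a K <= A) -> 0 < e ->
  exists M, forall M', (M <= M')%N -> forall L, csq (fun i => a (M' + i)%N) L <= e.
Proof.
move=> aA e0.
have nd : {homo csq a : n m / (n <= m)%N >-> n <= m} by move=> n m; exact: csq_mono.
have cv : cvgn (csq a).
  by apply: nondecreasing_is_cvgn => //; exists A => _ [N _ <-].
have le := nondecreasing_cvgn_le nd cv.
move/cvgrPdist_le : (cv) => /(_ e e0) [M _ h].
exists M => M' MM' L; have := le (M' + L)%N; have := h M' MM'.
rewrite ler_norml => /andP[_]; rewrite {3}/csq big_split_ord /= -!/(csq _ _) /=.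
rewrite /csq; lra.
Qed.

End HardyNorm.

(** * Composition operators from coefficient estimates *)

Section Composition.
Variable R : realType.
Implicit Types (z w : R[i]) (a c : nat -> R[i]) (b : nat -> R) (P : nat -> nat -> R).

Definition comb P L b k : R := \sum_(i < L) b i * P i k.
Definition ccomb P L a k : R[i] := \sum_(i < L) a i * (P i k)%:C%C.

(** The matrix with rows [P i], here the coefficients of [phi^i], has squared operator norm at most
    [kappa], tested on finite sections and real vectors; [csq_comb] extends this to complex ones. *)
Definition bounded_family P (kappa : R) := forall K L b,
  dot_seq K (comb P L b) (comb P L b) <= kappa * \sum_(i < L) b i ^+ 2.

Lemma csq_comb P kappa K L a : bounded_family P kappa ->
  csq (ccomb P L a) K <= kappa * csq a L.
Proof.
move=> PB; rewrite csqE.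
have -> : (fun k => complex.Re (ccomb P L a k)) = comb P L (fun i => complex.Re (a i)).
  apply/funext => k; rewrite /ccomb Re_sum; apply: eq_bigr => i _.
  by rewrite mulrC ReZ mulrC.
have -> : (fun k => complex.Im (ccomb P L a k)) = comb P L (fun i => complex.Im (a i)).
  apply/funext => k; rewrite /ccomb Im_sum; apply: eq_bigr => i _.
  by rewrite mulrC ImZ mulrC.
apply: le_trans (lerD (PB K L _) (PB K L _)) _.
rewrite -mulrDr -big_split /csq /=.
by under [in leRHS]eq_bigr => i _ do rewrite cabs_sq.
Qed.

Lemma bounded_family_shift P kappa M : bounded_family P kappa ->
  bounded_family (fun i => P (M + i)%N) kappa.
Proof.
move=> PB K L b; have := PB K (M + L)%N (fun j => if (j < M)%N then 0 else b (j - M)%N).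
have -> : comb P (M + L) (fun j => if (j < M)%N then 0 else b (j - M)%N) =
    comb (fun i => P (M + i)%N) L b.
  apply/funext => k; rewrite /comb big_split_ord /= big1 ?add0r => [|i _]; last first.
    by rewrite ltn_ord mul0r.
  by apply: eq_bigr => i _; rewrite ltnNge leq_addr /= addKn.
rewrite big_split_ord /= big1 ?add0r => [|i _]; last by rewrite ltn_ord expr0n.
by under eq_bigr => i _ do rewrite ltnNge leq_addr /= addKn.
Qed.

Lemma ccombS P M L a k : ccomb P (M + L) a k =
  ccomb P M a k + ccomb (fun i => P (M + i)%N) L (fun i => a (M + i)%N) k.
Proof. by rewrite /ccomb big_split_ord. Qed.

(** The matrix is tested on its own column [k]: if [s] is the square sum, entry [k] of the
    combination is [s], so [s^2 <= kappa s]. *)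
Lemma bounded_family_col P kappa k N : 0 <= kappa -> bounded_family P kappa ->
  \sum_(n < N) P n k ^+ 2 <= kappa.
Proof.
move=> k0 PB; have := PB k.+1 N (fun n => P n k); rewrite dotE0.
have -> : comb P N (fun n => P n k) k = \sum_(n < N) P n k ^+ 2.
  by apply: eq_bigr => n _; rewrite expr2.
have := dot_ge0 k (comb P N (fun n => P n k)).
have : 0 <= \sum_(n < N) P n k ^+ 2 by apply: sumr_ge0 => n _; exact: sqr_ge0.
set s := \sum_(n < N) _; set d := dot_seq _ _ _ => s0 d0 h.
case: (ltrP kappa s) => // ks; have : kappa * s < s * s; last by lra.
by rewrite ltr_pM2r//; exact: le_lt_trans ks.
Qed.

Lemma ccomb_cvg P kappa a (A : R) : 0 <= kappa -> bounded_family P kappa ->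
  (forall K, csq a K <= A) -> exists c, forall k, ctends (fun M => ccomb P M a k) (c k).
Proof.
move=> k0 PB aA.
suff /choice [c hc] : forall k, exists l, ctends (fun M => ccomb P M a k) l by exists c.
move=> k.
apply: (cvg_csum (a := fun n => a n * (P n k)%:C%C) (M := (A + kappa) / 2)) => N.
apply: le_trans (_ : (csq a N + \sum_(n < N) P n k ^+ 2) / 2 <= _).
  rewrite /csq -big_split mulr_suml; apply: ler_sum => n _ /=.
  rewrite cabsM cabs_real -[P n k ^+ 2]real_normK ?num_real//.
  by have := sqr_ge0 (cabs (a n) - `|P n k|); nra.
by have := aA N; have := bounded_family_col k N k0 PB; lra.
Qed.

Lemma ctends_sum (u : nat -> nat -> R[i]) (l : nat -> R[i]) M :
  (forall n, ctends (u n) (l n)) ->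
  ctends (fun N => \sum_(n < M) u n N) (\sum_(n < M) l n).
Proof.
move=> ul; elim: M => [|M IH].
  apply: (@ctends_bound _ (cst 0)) => [N|]; last exact: cvg_cst.
  by rewrite !big_ord0 subrr cabs0.
rewrite big_ord_recr (_ : (fun N => _) = fun N => \sum_(n < M) u n N + u M N).
  exact: ctendsD.
by apply/funext => N; rewrite big_ord_recr.
Qed.

Lemma powserD a c z N : powser (fun k => a k + c k) z N = powser a z N + powser c z N.
Proof. by rewrite /powser -big_split; apply: eq_bigr => n _; rewrite mulrDl. Qed.

Lemma powser_ccomb P M a z N :
  powser (ccomb P M a) z N = \sum_(n < M) a n * powser (cseq (P n)) z N.
Proof.
rewrite /powser; under eq_bigr => k _ do rewrite /ccomb mulr_suml.
rewrite exchange_big; apply: eq_bigr => n _; rewrite mulr_sumr.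
by apply: eq_bigr => k _; rewrite mulrA.
Qed.

Variables (phi : R[i] -> R[i]) (P : nat -> nat -> R) (kappa : R).
Hypothesis kappa0 : 0 <= kappa.
Hypothesis phi_disc : forall z, cabs z < 1 -> cabs (phi z) < 1.
Hypothesis P_eval : forall z n, cabs z < 1 ->
  ctends (powser (cseq (P n)) z) (phi z ^+ n).
Hypothesis P_bounded : bounded_family P kappa.

(** The coefficients of [f \o phi] are obtained as coefficientwise limits; that they sum to
    [f (phi z)] is an exchange of limits, controlled by the boundedness of [P] on tails of [a]. The
    bound [rho] is kept apart from [kappa] so that small images can be treated too. *)
Lemma comp_norm (f : R[i] -> R[i]) a (A rho : R) :
  taylor_on_disc f a -> (forall K, csq a K <= A) -> 0 <= rho ->
  (forall M K, csq (ccomb P M a) K <= rho ^+ 2) -> H2_norm_le (f \o phi) rho.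
Proof.
move=> /taylor_on_discE fa aA rho0 hrho; apply/H2_norm_leP; split=> //.
have [c cS] := ccomb_cvg kappa0 P_bounded aA.
exists c; split=> [|K]; last exact: (csq_lim (u := fun M => ccomb P M a)).
apply/taylor_on_discE => z z1; apply/ctendsP => e e0.
set q := 1 - cabs z ^+ 2.
have q0 : 0 < q by rewrite subr_gt0 exprn_ilt1// cabs_ge0.
(* A tail of [a] of squared norm [d] has an image of squared norm at most [kappa * d], and
   evaluation at [z] divides this by [q]; the result is at most [(e / 3)^2]. *)
pose d := q * (e / 3) ^+ 2 / (kappa + 1).
have k1 : 0 < kappa + 1 by rewrite ltr_wpDl.
have e3 : 0 < e / 3 by lra.
have d0 : 0 < d by rewrite divr_gt0// mulr_gt0// exprn_gt0.
have kd : kappa * d <= q * (e / 3) ^+ 2.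
  rewrite (_ : q * _ = (kappa + 1) * d); last by rewrite /d [RHS]mulrC divfK// lt0r_neq0.
  by rewrite mulrDl mul1r lerDl ltW.
have [M1 hM1] := csq_tail aA d0.
have [M3 _ hM3] := proj1 (ctendsP _ _) (fa (phi z) (phi_disc z1)) _ e3.
pose M := (M1 + M3)%N.
have tail N : cabs (powser (fun k => c k - ccomb P M a k) z N) <= e / 3.
  have : csq (fun k => c k - ccomb P M a k) N <= kappa * d.
    apply: (csq_lim (u := fun L k => ccomb P (M + L) a k - ccomb P M a k)) => [k|L].
      have : ctends (fun L => ccomb P (M + L) a k) (c k).
        apply/ctendsP => t t0; have [L0 _ hL0] := proj1 (ctendsP _ _) (cS k) t t0.
        by exists L0 => // L L0L; apply: hL0; rewrite /= (leq_trans L0L)// leq_addl.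
      move=> /ctendsP h; apply/ctendsP => t t0; have := h t t0; apply: filterS => L.
      by rewrite opprB addrA subrK.
    rewrite (_ : (fun k => _) = ccomb (fun i => P (M + i)%N) L (fun i => a (M + i)%N)).
      apply: le_trans (csq_comb _ _ _ (bounded_family_shift M P_bounded)) _.
      by rewrite ler_wpM2l// hM1// leq_addr.
    by apply/funext => k; rewrite ccombS addrAC subrr add0r.
  move=> h; have := powser_bound (fun k => c k - ccomb P M a k) N z1.
  rewrite -/q => h1.
  suff : cabs (powser (fun k => c k - ccomb P M a k) z N) ^+ 2 <= (e / 3) ^+ 2.
    by rewrite ler_pXn2r// nnegrE ?cabs_ge0// ltW.
  rewrite -(ler_pM2r q0) [leRHS]mulrC.
  exact: le_trans h1 (le_trans h kd).
have : ctends (powser (ccomb P M a) z) (\sum_(n < M) a n * phi z ^+ n).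
  rewrite (_ : powser _ _ = fun N => \sum_(n < M) a n * powser (cseq (P n)) z N).
    apply: (ctends_sum (u := fun n N => a n * powser (cseq (P n)) z N)
      (l := fun n => a n * phi z ^+ n)) => n.
    by apply: ctendsMl; exact: P_eval.
  by apply/funext => N; exact: powser_ccomb.
move=> /ctendsP/(_ _ e3); apply: filterS => N hN.
have -> : powser c z N - (f \o phi) z =
    powser (fun k => c k - ccomb P M a k) z N
    + (powser (ccomb P M a) z N - \sum_(n < M) a n * phi z ^+ n)
    + (powser a (phi z) M - f (phi z)).
  rewrite [powser a _ _]/powser /=.
  have := powserD (fun k => c k - ccomb P M a k) (ccomb P M a) z N.
  rewrite (_ : (fun k => _ + _) = c); last by apply/funext => k; rewrite subrK.
  move=> ->; ring.
have := hM3 M; rewrite /= leq_addl => /(_ isT) h3.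
apply: le_trans (cabsD _ _) _; apply: le_trans (lerD (cabsD _ _) h3) _.
have := tail N; lra.
Qed.

Lemma comp_bounded : comp_maps_H2 phi.
Proof.
move=> f [r /H2_norm_leP [r0 [a [fa ar]]]].
exists (Num.sqrt (kappa * r ^+ 2)).
have kr : 0 <= kappa * r ^+ 2 by rewrite mulr_ge0// sqr_ge0.
apply: (comp_norm fa ar); first exact: sqrtr_ge0.
move=> M K; rewrite sqr_sqrtr//; apply: le_trans (csq_comb _ _ _ P_bounded) _.
by rewrite ler_wpM2l.
Qed.

End Composition.

(** * Extraction of coefficientwise convergent subsequences *)

Section Subsequence.
Variable R : realType.

(** Tychonoff on a product of intervals indexed by coefficient and by real or imaginary part gives a
    cluster point. A neighbourhood constrains finitely many coordinates, so stage [k] matches the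
    first [k + 1] coefficients within [1 / (k + 1)]. *)
Lemma cvg_subsequence (u : nat -> nat -> R[i]) : (forall k n, cabs (u k n) <= 1) ->
  exists (sigma : nat -> nat) (a : nat -> R[i]), (forall k, (sigma k < sigma k.+1)%N) /\
  forall n, ctends (fun k => u (sigma k) n) (a n).
Proof.
move=> u1.
pose T (_ : nat * bool) : topologicalType := R.
pose X k : prod_topology T := fun i =>
  if i.2 then complex.Re (u k i.1) else complex.Im (u k i.1).
have [p [_ pX]] : [set f : prod_topology T | forall i, `[-1 : R, 1]%classic (f i)] `&`
    cluster (X @ \oo) !=set0.
  apply: (@tychonoff _ T (fun=> `[-1 : R, 1]%classic)).
    by move=> i; exact: segment_compact.
  exists 0%N => // k _ [n b] /=; rewrite in_itv /= -ler_norml /X /=.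
  by case: b; [apply: le_trans (u1 k n); exact: Re_le_cabs|
               apply: le_trans (u1 k n); exact: Im_le_cabs].
have step (km : nat * nat) : exists j, (km.2 < j)%N /\
    forall n b, (n <= km.1)%N -> `|(p (n, b) : R) - X j (n, b)| <= km.1.+1%:R^-1.
  case: km => k m /=.
  pose A := [set f : prod_topology T | exists2 j, (m < j)%N & f = X j].
  pose B := [set f : prod_topology T | forall i : 'I_k.+1 * bool,
    `|(p (val i.1, i.2) : R) - f (val i.1, i.2)| <= k.+1%:R^-1].
  have FA : (X @ \oo) A by exists m.+1 => // j mj; exists j.
  have FB : nbhs p B.
    apply: (@filter_forall _ _ (fun (i : 'I_k.+1 * bool) (f : prod_topology T) =>
      `|(p (val i.1, i.2) : R) - f (val i.1, i.2)| <= k.+1%:R^-1) (nbhs p)) => i.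
    pose q := (val i.1, i.2); pose pq : R := p q.
    have nq : nbhs pq [set x | `|pq - x| <= k.+1%:R^-1].
      have k0 : 0 < k.+1%:R^-1 :> R by rewrite invr_gt0.
      by have /cvgrPdist_le/(_ _ k0) := @cvg_id _ (nbhs pq).
    exact: (@proj_continuous _ T q p _ nq).
  have [_ [[j mj ->] Bj]] := pX A B FA FB.
  exists j; split=> // n b nk; have := Bj (Ordinal (nk : (n < k.+1)%N), b); exact.
have [g hg] := choice step.
pose sigma := fix s k := if k is k'.+1 then g (k, s k') else g (0%N, 0%N).
have sP k : forall n b, (n <= k)%N -> `|(p (n, b) : R) - X (sigma k) (n, b)| <= k.+1%:R^-1.
  by case: k => [|k]; [have [] := hg (0, 0)%N|have [] := hg (k.+1, sigma k)].
exists sigma, (fun n => Complex (p (n, true)) (p (n, false))); split=> [k|n].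
  by have [] := hg (k.+1, sigma k).
apply/ctendsP => e e0.
have e2 : 0 < e / 2 by lra.
have /cvgr0Pnorm_le /(_ _ e2) := @cvg_harmonic R.
have : \forall k \near \oo, (n <= k)%N by exact: nbhs_infty_ge.
apply: filterS2 => k nk; rewrite /harmonic /= ger0_norm ?invr_ge0// => hk.
apply: le_trans (cabs_le_ReIm _) _; rewrite ReD ImD /=.
have := sP k n true nk; have := sP k n false nk; rewrite /X /=.
case: (u (sigma k) n) => x y /=.
rewrite (distrC (p (n, false))) (distrC (p (n, true))) => h1 h2.
by rewrite (splitr e); exact: lerD (le_trans h2 hk) (le_trans h1 hk).
Qed.

End Subsequence.

(** * Compactness from smallness on high powers *)

Section CompactComposition.
Variable R : realType.
Variables (phi : R[i] -> R[i]) (P : nat -> nat -> R) (kappa : R).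
Hypothesis kappa0 : 0 <= kappa.
Hypothesis phi_disc : forall z, cabs z < 1 -> cabs (phi z) < 1.
Hypothesis P_eval : forall z n, cabs z < 1 ->
  ctends (powser (cseq (P n)) z) (phi z ^+ n).
Hypothesis P_bounded : bounded_family P kappa.
Hypothesis P_tail : forall e : R, 0 < e ->
  exists N, bounded_family (fun i => P (N + i)%N) e.

Lemma csq_ccomb_small N (e : R) M K (b : nat -> R[i]) : 0 <= e ->
  bounded_family (fun i => P (N + i)%N) e ->
  csq (ccomb P M b) K <= 2 * kappa * csq b N + 2 * e * csq b M.
Proof.
move=> e0 Pe; case: (leqP M N) => MN.
  apply: le_trans (csq_comb _ _ _ P_bounded) _.
  have := ler_wpM2l kappa0 (csq_mono b MN).
  have := mulr_ge0 kappa0 (csq_ge0 b N); have := mulr_ge0 e0 (csq_ge0 b M); lra.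
have EM : M = (N + (M - N))%N by lia.
have -> : ccomb P M b = fun k => ccomb P N b k
    + ccomb (fun i => P (N + i)%N) (M - N) (fun i => b (N + i)%N) k.
  by apply/funext => k; rewrite {1}EM ccombS.
apply: le_trans (csqD_le _ _ _) _.
have h1 := csq_comb K N b P_bounded.
have h2 := csq_comb K (M - N) (fun i => b (N + i)%N) Pe.
have h3 : csq (fun i => b (N + i)%N) (M - N) <= csq b M.
  rewrite {2}EM {2}/csq big_split_ord /= lerDr.
  by apply: sumr_ge0 => k _; rewrite sqr_ge0.
have := ler_wpM2l e0 h3; lra.
Qed.

(** Along a coefficientwise convergent subsequence the differences [b k] from the limit are bounded,
    and each of their coefficients tends to 0. The first [N] coefficients then have a small image by
    convergence, the others by [P_tail], uniformly in [k]. *)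
Lemma comp_compact_of_tail : comp_compact phi.
Proof.
move=> f f1.
have /choice [a ha] : forall k, exists a, taylor_on_disc (f k) a /\ forall K, csq a K <= 1.
  move=> k; have /H2_norm_leP [_ [a [fa a1]]] := f1 k.
  by exists a; split=> // K; have := a1 K; rewrite expr1n.
have a1 k n : cabs (a k n) <= 1.
  have h : cabs (a k n) ^+ 2 <= 1.
    apply: le_trans (proj2 (ha k) n.+1); rewrite /csq big_ord_recr /= lerDr.
    by apply: sumr_ge0 => i _; rewrite sqr_ge0.
  by rewrite -(expr1n R 2) ler_pXn2r ?nnegrE ?cabs_ge0 in h.
have [sigma [l [sS al]]] := cvg_subsequence a1.
exists sigma; split=> //.
have l1 K : csq l K <= 1.
  by apply: (csq_lim (u := fun k => a (sigma k))) => // k; exact: (proj2 (ha _)).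
(* The limit function is the sum of the limit series in the disc, with the arbitrary value 0
   outside. *)
have /choice [g0 hg0] : forall z, exists w, cabs z < 1 -> ctends (powser l z) w.
  move=> z; case: (ltrP (cabs z) 1) => z1; last by exists 0.
  have z0 := cabs_ge0 z.
  suff /(cvg_csum (a := fun n => l n * z ^+ n)) [w hw] : forall N, \sum_(n < N) cabs (l n * z ^+ n) <= (1 - cabs z)^-1.
    by exists w.
  move=> N; have p : 0 < 1 - cabs z by rewrite subr_gt0.
  rewrite -[leRHS]mul1r ler_pdivlMr//.
  apply: le_trans (_ : (\sum_(n < N) cabs z ^+ n) * (1 - cabs z) <= _).
    apply: ler_wpM2r; [exact: ltW|apply: ler_sum => n _].
    rewrite cabsM cabsX ler_piMl ?exprn_ge0//.
    have h : cabs (l n) ^+ 2 <= 1.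
      apply: le_trans (l1 n.+1); rewrite /csq big_ord_recr /= lerDr.
      by apply: sumr_ge0 => i _; rewrite sqr_ge0.
    by rewrite -(expr1n R 2) ler_pXn2r ?nnegrE ?cabs_ge0 in h.
  suff -> : (\sum_(n < N) cabs z ^+ n) * (1 - cabs z) = 1 - cabs z ^+ N.
    by rewrite gerBl exprn_ge0.
  elim: N => [|N IH]; first by rewrite big_ord0 mul0r expr0 subrr.
  rewrite big_ord_recr /= mulrDl IH exprS; ring.
have g0l : taylor_on_disc g0 l by apply/taylor_on_discE.
exists (g0 \o phi); split.
  apply: (comp_bounded kappa0 phi_disc P_eval P_bounded); exists 1; apply/H2_norm_leP.
  by split=> //; exists l; split=> // K; rewrite expr1n.
move=> e e0.
(* The tail contributes [2 d] times the bound 4 on [csq (b k)], that is [e^2 / 2]; the threshold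
   [e^2 / (4 (kappa + 1))] on the head leaves the other half. *)
pose d := e ^+ 2 / 16.
have e2 : 0 < e ^+ 2 by rewrite exprn_gt0.
have d0 : 0 < d by rewrite divr_gt0.
have [N PN] := P_tail d0.
pose b k n := a (sigma k) n - l n.
have b4 k K : csq (b k) K <= 4.
  apply: le_trans (csqD_le _ (fun n => - l n) _) _; rewrite csqN.
  have := l1 K; have := proj2 (ha (sigma k)) K; lra.
have bcv : (fun k => csq (b k) N) @ \oo --> (0 : R).
  rewrite /csq; elim: N {PN} => [|N IH].
    rewrite (_ : (fun k => _) = cst 0); first exact: cvg_cst.
    by apply/funext => k; rewrite big_ord0.
  rewrite (_ : (fun k => _) = fun k => \sum_(i < N) cabs (b k i) ^+ 2 + cabs (b k N) * cabs (b k N)).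
    rewrite -[X in _ --> X](addr0 0); apply: cvgD => //.
    by rewrite -[X in _ --> X](mulr0 0); apply: cvgM; exact: al.
  by apply/funext => k; rewrite big_ord_recr expr2.
have k1 : 0 < 4 * (kappa + 1) by rewrite mulr_gt0// ltr_wpDl.
have t0 : 0 < e ^+ 2 / (4 * (kappa + 1)) by rewrite divr_gt0.
have /cvgr0Pnorm_le/(_ _ t0) := bcv.
apply: filterS => k; rewrite ger0_norm ?csq_ge0// ler_pdivlMr// => hk.
have fb : taylor_on_disc (fun z => f (sigma k) z - g0 z) (b k).
  apply/taylor_on_discE => z z1.
  have h1 := proj1 (taylor_on_discE _ _) (proj1 (ha (sigma k))) z z1.
  have h2 := ctendsMl (-1) (hg0 z z1).
  have := ctendsD h1 h2; rewrite mulN1r.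
  rewrite (_ : (fun n => _ + _) = powser (b k) z)//.
  apply/funext => n; rewrite mulN1r /powser -sumrB; apply: eq_bigr => i _.
  by rewrite mulrBl.
apply: (comp_norm kappa0 phi_disc P_eval P_bounded fb (b4 k) (ltW e0)) => M K.
apply: le_trans (csq_ccomb_small M K (b k) (ltW d0) PN) _.
have h3 := ler_wpM2l (ltW d0) (b4 k M); have := csq_ge0 (b k) N.
rewrite /d in h3 *; move: kappa0 hk => h4 hk h5; lra.
Qed.

End CompactComposition.

(** * The two symbols *)

Section Symbols.
Variable R : realType.
Implicit Types (z w : R[i]) (y b : nat -> R).

Definition phi1 z : R[i] := (1 + z) / 2.
Definition phi2 z : R[i] := inner_fun z * phi1 z.

Lemma dot_unit_seq K u (a : R) : dot_seq K.+1 u (fun k => a * unit_seq k) = a * u 0%N.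
Proof.
rewrite /dot_seq big_ord_recl big1 ?addr0 /unit_seq /= ?mulr1; first by rewrite mulrC.
by move=> i _; rewrite mulr0 mulr0.
Qed.

Section Powers.
Variables (T : (nat -> R) -> nat -> R) (s : R).
Hypothesis linT : linop T.
Hypothesis contrT : forall K y, dot_seq K (T y) (T y) <= dot_seq K y y.
Hypothesis T0 : forall y, T y 0%N = s * y 0%N.
Hypothesis s01 : 0 <= s <= 1.

(* Taylor coefficients of the [n]-th power of [S (1 + z) / 2], if [T] is multiplication
   by [S]. *)
Definition pow_seq n := iter n (fun y => T (half_shift y)) unit_seq.

Lemma linop_step : linop (fun y => T (half_shift y)).
Proof. by move=> a u v; rewrite linop_half_shift linT. Qed.

(* One Horner step [b + T E y], [E = (1 + z) / 2]: the cross term [b s y_0] is absorbed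
   by the defect [|E y|^2 <= |y|^2 - y_0^2 / 4]. *)
Lemma bounded_pow_seq : bounded_family pow_seq 2.
Proof.
case=> [|K] L b.
  rewrite /dot_seq big_ord0 mulr_ge0//; apply: sumr_ge0 => i _; exact: sqr_ge0.
elim: L b => [|L IH] b.
  rewrite big_ord0 mulr0 /dot_seq big1// => k _; by rewrite /comb big_ord0 mul0r.
set w := comb pow_seq L (fun i => b i.+1).
have -> : comb pow_seq L.+1 b = fun k => b 0%N * unit_seq k + T (half_shift w) k.
  apply/funext => k; rewrite /comb big_ord_recl; congr (_ + _).
  have := linop_sum L (fun i => b i.+1) pow_seq linop_step.
  by move=> /(congr1 (fun f => f k)) /= ->.
rewrite dot_sqD !dot_unit_seq T0 big_ord_recl /= mulrDr.
have h1 := le_trans (contrT K.+1 (half_shift w)) (dot_half_shift_le0 K w).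
have h2 := IH (fun i => b i.+1); rewrite -/w in h2.
have e0 : half_shift w 0 = w 0%N / 2 by rewrite /half_shift /= addr0.
rewrite e0 /unit_seq /=; have /andP[s0 s1] := s01.
set S := \sum_(i < L) _ in h2 *.
(* The part [w_0^2 / 4] cancels the defect, and the part [b_0^2] doubles the square already present:
   hence the constant 2. *)
have Q : 2 * (b 0%N * (s * (w 0%N / 2))) <= b 0%N ^+ 2 + w 0%N ^+ 2 / 4.
  have q1 := sqr_ge0 (b 0%N - w 0%N / 2).
  have q2 := sqr_ge0 (b 0%N + w 0%N / 2).
  have : b 0%N * w 0%N * s <= `|b 0%N * w 0%N|.
    apply: le_trans (ler_norm _) _; rewrite normrM (ger0_norm s0).
    by rewrite ler_piMr.
  have : `|b 0%N * w 0%N| <= b 0%N ^+ 2 + w 0%N ^+ 2 / 4.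
    by rewrite ler_norml; apply/andP; split; lra.
  lra.
lra.
Qed.

Lemma l2_pow_seq n : l2_le 1 (pow_seq n).
Proof.
elim: n => [|n IH] K.
  case: K => [|K]; first by rewrite /dot_seq big_ord0.
  by rewrite /dot_seq big_ord_recl big1 => [|i _]; rewrite /unit_seq /= ?mulr0// addr0 mulr1.
by apply: le_trans (contrT _ _) (le_trans (dot_half_shift_le _ _) (IH K)).
Qed.

Lemma pow_seq_eval (S : R[i] -> R[i]) z n : cabs z < 1 ->
  (forall B y Y, l2_le B y -> ctends (powser (cseq y) z) Y ->
     ctends (powser (cseq (T y)) z) (S z * Y)) ->
  ctends (powser (cseq (pow_seq n)) z) ((S z * phi1 z) ^+ n).
Proof.
move=> z1 evalT; elim: n => [|n IH].
  apply/ctendsP => e e0.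
  have : \forall k \near \oo, (1 <= k)%N by exact: nbhs_infty_ge.
  apply: filterS => -[//|k] _; rewrite /powser big_ord_recl big1 => [|i _].
    by rewrite addr0 /cseq /unit_seq /= expr0 mulr1 subrr cabs0 ltW.
  by rewrite /cseq /unit_seq /= mul0r.
rewrite exprS -mulrA; apply: (evalT 1).
  by move=> K; apply: le_trans (dot_half_shift_le _ _) (l2_pow_seq n K).
by apply: (half_shift_eval z1 (l2_pow_seq n)).
Qed.

End Powers.

Local Notation T := (@flow R 1).

Lemma linop_flow : linop T. Proof. exact: linop_inner. Qed.

Lemma flow_coef0 y : T y 0%N = expR (- 1) * y 0%N. Proof. exact: inner_op0. Qed.

Lemma flow_contr1 K y : dot_seq K (T y) (T y) <= dot_seq K y y.
Proof. exact: flow_contr. Qed.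

Lemma expN1_01 : 0 <= expR (- 1 : R) <= 1.
Proof. by rewrite expR_ge0 /= -expR0 ler_expR oppr_le0. Qed.

(** Multiplications by [S] and by [(1 + z) / 2] commute, so the power factors as [S^n c_n], the form
    in which the Gram estimates apply. *)
Lemma pow_seq_flowE n : pow_seq T n = iter n T (binom_seq R n).
Proof.
elim: n => // n IH; rewrite /pow_seq iterS -/(pow_seq T n) IH binom_seqS iterS.
congr (T _); rewrite (iter_comm (F := T) (G := half_shift))// => z.
exact: inner_half_shift.
Qed.

Lemma cabs2 : cabs (2 : R[i]) = 2.
Proof.
rewrite (_ : 2 = 2%:C%C); last by rewrite rmorph_nat.
by rewrite cabs_real ger0_norm.
Qed.

Lemma phi1_disc z : cabs z < 1 -> cabs (phi1 z) < 1.
Proof.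
move=> z1; rewrite cabsM cabsV cabs2 ltr_pdivrMr// mul1r.
apply: le_lt_trans (cabsD _ _) _; rewrite cabsE Normc.normc1; lra.
Qed.

Lemma phi2_disc z : cabs z < 1 -> cabs (phi2 z) < 1.
Proof.
move=> z1; rewrite cabsM; apply: le_lt_trans (phi1_disc z1).
by rewrite ler_piMl ?cabs_ge0// cabs_inner_le1.
Qed.

Lemma phi1_eval z n : cabs z < 1 ->
  ctends (powser (cseq (pow_seq id n)) z) (phi1 z ^+ n).
Proof.
move=> z1; rewrite -[phi1 z]mul1r.
apply: (@pow_seq_eval id (fun _ _ => lexx _) (cst 1) z n z1) => B y Y yB.
by rewrite mul1r.
Qed.

Lemma phi2_eval z n : cabs z < 1 ->
  ctends (powser (cseq (pow_seq T n)) z) (phi2 z ^+ n).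
Proof.
move=> z1; apply: pow_seq_eval => //; first exact: flow_contr1.
by move=> B y Y; exact: flow_eval.
Qed.

Lemma phi1_bounded : bounded_family (pow_seq (@id (nat -> R))) 2.
Proof. by apply: (@bounded_pow_seq _ 1) => // [y|]; rewrite ?mul1r// ler01 lexx. Qed.

Lemma phi2_bounded : bounded_family (pow_seq T) 2.
Proof.
exact: (bounded_pow_seq linop_flow flow_contr1 flow_coef0 expN1_01).
Qed.

Lemma phi2_tail (e : R) : 0 < e ->
  exists N, bounded_family (fun i => pow_seq T (N + i)%N) e.
Proof.
have eulerT y k : euler (T y) k =
    T (euler y) k - 2 * T (fun i => psum y i + psum (psum y) i) k.
  by rewrite /flow euler_inner mulr1.
move=> /(tail_small linop_flow (inner_shift _ _) (inner_psum _ _) flow_contr1 eulerT).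
move=> [N hN]; exists N => K L b; have := hN K L b.
rewrite /comb; have -> : (fun k => \sum_(i < L) b i * pow_seq T (N + i) k) =
    fun k => \sum_(i < L) b i * iter (N + i) T (binom_seq R (N + i)) k.
  by apply/funext => k; apply: eq_bigr => i _; rewrite pow_seq_flowE.
exact.
Qed.

Lemma phi1_analytic : analytic_selfmap phi1.
Proof.
split; last by move=> z; rewrite !inE; exact: phi1_disc.
exists (cseq (pow_seq id 1)); apply/taylor_on_discE => z z1.
by have := phi1_eval 1 z1; rewrite expr1.
Qed.

Lemma phi2_analytic : analytic_selfmap phi2.
Proof.
split; last by move=> z; rewrite !inE; exact: phi2_disc.
exists (cseq (pow_seq T 1)); apply/taylor_on_discE => z z1.
by have := phi2_eval 1 z1; rewrite expr1.
Qed.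

Lemma phi1_maps : comp_maps_H2 phi1.
Proof. exact: (comp_bounded (ler0n R 2) phi1_disc (fun z n => @phi1_eval z n) phi1_bounded). Qed.

Lemma phi2_maps : comp_maps_H2 phi2.
Proof. exact: (comp_bounded (ler0n R 2) phi2_disc (fun z n => @phi2_eval z n) phi2_bounded). Qed.

Lemma phi2_compact : comp_compact phi2.
Proof.
exact: (comp_compact_of_tail (ler0n R 2) phi2_disc (fun z n => @phi2_eval z n)
  phi2_bounded phi2_tail).
Qed.

Lemma H2_eval_bound (f : R[i] -> R[i]) (r : R) z : H2_norm_le f r -> cabs z < 1 ->
  cabs (f z) ^+ 2 * (1 - cabs z ^+ 2) <= r ^+ 2.
Proof.
move=> /H2_norm_leP[r0 [a [/taylor_on_discE fa ar]]] z1.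
have q0 : 0 < 1 - cabs z ^+ 2 by rewrite subr_gt0 exprn_ilt1// cabs_ge0.
rewrite -ler_pdivlMr//.
have h N : cabs (powser a z N) <= Num.sqrt (r ^+ 2 / (1 - cabs z ^+ 2)).
  rewrite -[cabs _]ger0_norm ?cabs_ge0// -sqrtr_sqr ler_wsqrtr// ler_pdivlMr//.
  exact: le_trans (powser_bound _ _ z1) (ar N).
have hc : cabs (f z) <= Num.sqrt (r ^+ 2 / (1 - cabs z ^+ 2)).
  by apply: (ctends_le (fa z z1)); exact: nearW.
have B0 : 0 <= r ^+ 2 / (1 - cabs z ^+ 2) by rewrite divr_ge0 ?sqr_ge0// ltW.
by rewrite -(sqr_sqrtr B0) ler_pXn2r// nnegrE ?cabs_ge0// sqrtr_ge0.
Qed.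

(* Normalised reproducing (Szego) function of [H^2] at the point [x] of [(0, 1)]. *)
Definition szego_kernel (x : R) z : R[i] := (Num.sqrt (1 - x ^+ 2))%:C%C / (1 - x%:C%C * z).

Lemma szego_kernel_norm (x : R) : 0 <= x < 1 -> H2_norm_le (szego_kernel x) 1.
Proof.
move=> /andP[x0 x1]; apply/H2_norm_leP; split=> //.
set s := Num.sqrt (1 - x ^+ 2).
have s2 : s ^+ 2 = 1 - x ^+ 2 by rewrite sqr_sqrtr// subr_ge0 exprn_ile1// ltW.
exists (fun n => (s * x ^+ n)%:C%C); split=> [|K]; last first.
  suff -> : csq (fun n => (s * x ^+ n)%:C%C) K = 1 - (x ^+ K) ^+ 2.
    by rewrite expr1n gerBl sqr_ge0.
  elim: K => [|K IH]; first by rewrite /csq big_ord0 expr0 expr1n subrr.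
  rewrite /csq in IH *; rewrite big_ord_recr IH cabs_real real_normK ?num_real//.
  by rewrite /= exprMn s2 (exprS x K); ring.
apply/taylor_on_discE => z z1; set w := x%:C%C * z.
have w1 : cabs w < 1.
  rewrite /w cabsM cabs_real ger0_norm//.
  by apply: le_lt_trans z1; rewrite ler_piMl ?cabs_ge0// ltW.
have w0 : 1 - w != 0 by exact: cabs_pos_1B.
have E N : powser (fun n => (s * x ^+ n)%:C%C) z N = s%:C%C * (1 - w ^+ N) / (1 - w).
  apply: (mulIf w0); rewrite divfK//; elim: N => [|N IH].
    by rewrite /powser big_ord0 mul0r expr0 subrr mulr0.
  rewrite powserS mulrDl IH rmorphM rmorphXn exprS /w exprMn; ring.
apply: (@ctends_bound _ (fun N => s / cabs (1 - w) * cabs w ^+ N)) => [N|]; last first.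
  rewrite -[X in _ --> X](mulr0 (s / cabs (1 - w))); apply: cvgMr.
  by apply: cvg_expr0; rewrite cabs_ge0.
rewrite E /szego_kernel -/s -/w.
rewrite (_ : _ - _ = - (s%:C%C / (1 - w) * w ^+ N)); last by ring.
by rewrite cabsN cabsM [cabs (_ / _)]cabsM cabsV cabsX cabs_real (ger0_norm (sqrtr_ge0 _ : 0 <= s)).
Qed.

Lemma phi1_real (x : R) : phi1 x%:C%C = ((1 + x) / 2)%:C%C.
Proof. by rewrite /phi1 rmorphM rmorphD rmorph1 fmorphV rmorph_nat. Qed.

Lemma szego_kernel_real (x y : R) :
  szego_kernel x y%:C%C = (Num.sqrt (1 - x ^+ 2) / (1 - x * y))%:C%C.
Proof. by rewrite /szego_kernel rmorphM fmorphV rmorphB rmorph1 rmorphM. Qed.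

Lemma phi1_not_compact : ~ comp_compact phi1.
Proof.
pose om n : R := 1 - n.+2%:R^-1.
have om01 n : 0 <= om n < 1.
  by rewrite subr_ge0 gtrBl invr_gt0 ltr0n andbT invf_le1// ler1n.
move=> /(_ (fun n => szego_kernel (om n)) (fun n => szego_kernel_norm (om01 n))).
move=> [sigma [sS [g [_ hg]]]].
have sk k : (k <= sigma k)%N.
  by elim: k => // k IH; apply: leq_ltn_trans (sS k).
(* At fixed [x] the normalising factor [sqrt (1 - w^2)] tends to 0 as [w -> 1], while
   [1 - w y >= 1 - y] for [y = phi1 x]. Real points suffice, as the contradiction is drawn at
   [x = w]. *)
have g0 (x : R) : 0 <= x < 1 -> g x%:C%C = 0.
  move=> /andP[x0 x1]; apply: cabs_eq0; apply/eqP; rewrite eq_le cabs_ge0 andbT leNgt.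
  apply/negP => c0; set c := cabs _ in c0.
  have cx : cabs x%:C%C = x by rewrite cabs_real ger0_norm.
  have q0 : 0 < 1 - x ^+ 2 by rewrite subr_gt0 exprn_ilt1.
  have q1 : 1 - x ^+ 2 <= 1 by rewrite gerBl sqr_ge0.
  (* The factor [1 - x^2 <= 1] in the tolerance absorbs the loss in [H2_eval_bound], leaving an
     error [c / 2] at [x]. The value [t] below makes the kernel at most [c / 4] there, through
     [1 - w^2 <= 2 (1 - w) <= t^2]; then [c <= c / 4 + c / 2] is absurd. *)
  have e0 : 0 < c / 2 * (1 - x ^+ 2) by rewrite mulr_gt0// divr_gt0.
  pose y := (1 + x) / 2; have y1 : 0 < 1 - y by rewrite /y; lra.
  have y0 : 0 <= y by rewrite /y; lra.
  pose t := c / 4 * (1 - y); have t0 : 0 < t by rewrite mulr_gt0// divr_gt0.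
  have t2 : 0 < t ^+ 2 / 2 by rewrite divr_gt0// exprn_gt0.
  have /cvgr0Pnorm_le/(_ _ t2) hh := @cvg_harmonic R.
  have [k [hk1 hk2]] : exists k, H2_norm_le (fun z => szego_kernel (om (sigma k)) (phi1 z) - g z)
      (c / 2 * (1 - x ^+ 2)) /\ `|harmonic k : R| <= t ^+ 2 / 2.
    exact: (filter_ex (filterI (hg _ e0) hh)).
  have := H2_eval_bound (z := x%:C%C) hk1; rewrite cx => /(_ x1).
  rewrite phi1_real -/y szego_kernel_real; set w := om (sigma k).
  have /andP[w0 w1] := om01 (sigma k); rewrite -/w in w0 w1.
  set K := _ / (1 - w * y) => h.
  have wy : 0 < 1 - w * y by nra.
  have Kc : cabs (K%:C%C : R[i]) <= c / 4.
    rewrite cabs_real /K ger0_norm; last by rewrite divr_ge0 ?sqrtr_ge0// ltW.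
    rewrite ler_pdivrMr//.
    apply: le_trans (_ : t <= _); last by rewrite /t ler_pM2l ?divr_gt0//; nra.
    have tE : t = Num.sqrt (t ^+ 2) by rewrite sqrtr_sqr ger0_norm// ltW.
    rewrite tE; apply: ler_wsqrtr.
    have : 1 - w <= t ^+ 2 / 2.
      rewrite /w /om subKr; apply: le_trans hk2.
      rewrite ger0_norm /harmonic ?invr_ge0//= lef_pV2 ?posrE ?ltr0n//.
      by rewrite ler_nat ltnS; apply: leqW; exact: sk.
    nra.
  have hc : cabs (K%:C%C - g x%:C%C) <= c / 2.
    suff : cabs (K%:C%C - g x%:C%C) ^+ 2 <= (c / 2) ^+ 2.
      by rewrite ler_pXn2r// nnegrE ?cabs_ge0// ltW// divr_gt0.
    rewrite -(ler_pM2r q0); apply: le_trans h _.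
    rewrite (exprMn _ (c / 2)); apply: ler_wpM2l; first exact: sqr_ge0.
    by rewrite expr2 ler_piMr// ltW.
  have := cabsB (K%:C%C) (K%:C%C - g x%:C%C); rewrite subKr -/c; lra.
have h2 : 0 < 1 / 2 :> R by lra.
have [k hk] : exists k, H2_norm_le (fun z => szego_kernel (om (sigma k)) (phi1 z) - g z) (1 / 2).
  exact: (filter_ex (hg _ h2)).
set w := om (sigma k) in hk; have w01 := om01 (sigma k); rewrite -/w in w01.
have /andP[w0 w1] := w01.
have cw : cabs w%:C%C = w by rewrite cabs_real ger0_norm.
have := H2_eval_bound (z := w%:C%C) hk; rewrite cw => /(_ w1).
rewrite g0// subr0 phi1_real szego_kernel_real cabs_real real_normK ?num_real//.
have q0 : 0 <= 1 - w ^+ 2 by rewrite subr_ge0 exprn_ile1// ltW.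
rewrite exprMn exprVn sqr_sqrtr//.
have d0 : 0 < 1 - w * ((1 + w) / 2) by nra.
have p : 0 < (1 - w) ^+ 2 by rewrite exprn_gt0// subr_gt0.
rewrite mulrAC ler_pdivrMr ?exprn_gt0//.
(* Since [1 - w (1 + w) / 2 = (1 - w) (2 + w) / 2], both sides contain [(1 - w)^2], and
   [(1 + w)^2 <= (2 + w)^2 / 16] fails for [w >= 0]. *)
have -> : (1 - w ^+ 2) * (1 - w ^+ 2) = (1 - w) ^+ 2 * (1 + w) ^+ 2 by ring.
have -> : (1 / 2) ^+ 2 * (1 - w * ((1 + w) / 2)) ^+ 2 =
   (1 - w) ^+ 2 * ((2 + w) ^+ 2 / 16) by field.
rewrite ler_pM2l//; nra.
Qed.

End Symbols.

(** * Radial limits *)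

Section RadialLimits.
Variable R : realType.
Implicit Types (F G : R -> R[i]).

(** Componentwise and two-sided: the explicit formulas extend past the circle along a ray, so real
    limit rules apply at [r = 1] and the left limit follows by restriction. *)
Definition ccont F (r : R) :=
  (fun s => complex.Re (F s)) @ r --> complex.Re (F r) /\
  (fun s => complex.Im (F s)) @ r --> complex.Im (F r).

Lemma ccontM F G r : ccont F r -> ccont G r -> ccont (fun s => F s * G s) r.
Proof.
have ReM (z w : R[i]) : complex.Re (z * w) =
    complex.Re z * complex.Re w - complex.Im z * complex.Im w.
  by case: z w => [? ?] [? ?].
have ImM (z w : R[i]) : complex.Im (z * w) =
    complex.Re z * complex.Im w + complex.Im z * complex.Re w.
  by case: z w => [? ?] [? ?].
move=> [F1 F2] [G1 G2]; split.
  rewrite ReM (_ : (fun s => _) = fun s => complex.Re (F s) * complex.Re (G s)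
    - complex.Im (F s) * complex.Im (G s)); last by apply/funext => s; exact: ReM.
  by apply: cvgB; exact: cvgM.
rewrite ImM (_ : (fun s => _) = fun s => complex.Re (F s) * complex.Im (G s)
  + complex.Im (F s) * complex.Re (G s)); last by apply/funext => s; exact: ImM.
by apply: cvgD; exact: cvgM.
Qed.

Lemma ccont_radial_limit (phi : R[i] -> R[i]) t :
  ccont (fun r => phi (r%:C%C * expi t)) 1 -> radial_limit phi t (phi (expi t)).
Proof.
rewrite /ccont mul1r => -[c1 c2]; rewrite /radial_limit.
set F := fun r : R => phi (r%:C%C * expi t) in c1 c2 *.
have d1 : (fun r => `|complex.Re (F r) - complex.Re (phi (expi t))|) @ at_left 1 --> (0 : R).
  move/subr_cvg0 : c1 => /cvg_norm; rewrite normr0; exact: cvg_within_filter.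
have d2 : (fun r => `|complex.Im (F r) - complex.Im (phi (expi t))|) @ at_left 1 --> (0 : R).
  move/subr_cvg0 : c2 => /cvg_norm; rewrite normr0; exact: cvg_within_filter.
have d := cvgD d1 d2; rewrite addr0 in d.
pose B r := `|complex.Re (F r) - complex.Re (phi (expi t))|
  + `|complex.Im (F r) - complex.Im (phi (expi t))|.
apply: (@squeeze_cvgr _ _ _ _ (cst 0) B); [|exact: cvg_cst|exact: d].
apply: nearW => r /=; rewrite cabs_ge0 /=; apply: le_trans (cabs_le_ReIm _) _.
by rewrite ReD ImD /B /F; case: (phi (expi t)).
Qed.

Lemma ray_ReIm (r t : R) : r%:C%C * expi t = Complex (r * cos t) (r * sin t).
Proof. by apply/eqP; rewrite eq_complex /= !mul0r subr0 addr0 !eqxx. Qed.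

Lemma cvg_scale (a r : R) : (fun s : R => s * a) @ r --> r * a.
Proof. by apply: cvgM; [exact: cvg_id|exact: cvg_cst]. Qed.

Lemma ccont_phi1 t : ccont (fun r => @phi1 R (r%:C%C * expi t)) 1.
Proof.
apply: (@ccontM (fun r => 1 + r%:C%C * expi t) (fun=> 2^-1)); last first.
  by split; exact: cvg_cst.
rewrite /ccont; split.
  rewrite (_ : (fun s => _) = fun s => 1 + s * cos t); last first.
    by apply/funext => s; rewrite ReD ray_ReIm.
  rewrite ReD ray_ReIm /=; apply: cvgD; [exact: cvg_cst|exact: cvg_scale].
rewrite (_ : (fun s => _) = fun s => 0 + s * sin t); last first.
  by apply/funext => s; rewrite ImD ray_ReIm.
by rewrite ImD ray_ReIm /=; apply: cvgD; [exact: cvg_cst|exact: cvg_scale].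
Qed.

Lemma den_expi_gt0 t : cos t != 1 :> R -> 0 < den (expi t).
Proof.
move=> c1; rewrite /den /=.
have : 0 < (1 - cos t) ^+ 2 by rewrite exprn_even_gt0//= subr_eq0 eq_sym.
by have := sqr_ge0 (sin t); lra.
Qed.

Lemma ccont_inner t : cos t != 1 :> R -> ccont (fun r => inner_fun (r%:C%C * expi t)) 1.
Proof.
move=> c1; have d0 := den_expi_gt0 c1.
have cvg2 (f : R -> R) (a : R) : f @ (1 : R) --> a -> (fun s => f s ^+ 2) @ (1 : R) --> a ^+ 2.
  by move=> fa; exact: (cvgM fa fa).
pose x (s : R) := s * cos t; pose y (s : R) := s * sin t.
have cx : x @ (1 : R) --> x 1 by exact: cvg_scale.
have cy : y @ (1 : R) --> y 1 by exact: cvg_scale.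
have one : cst 1 @ (1 : R) --> (1 : R) by exact: cvg_cst.
pose D s := (1 - x s) ^+ 2 + y s ^+ 2.
have D1 : D 1 != 0 by rewrite /D /x /y !mul1r; exact: lt0r_neq0.
have cD : D @ (1 : R) --> D 1.
  by rewrite /D; apply: cvgD; [apply: cvg2; exact: cvgB|exact: cvg2].
pose u s := - ((1 - x s ^+ 2 - y s ^+ 2) / D s).
pose v s := - (2 * y s / D s).
have cu : u @ (1 : R) --> u 1.
  apply: cvgN; apply: cvgM; last exact: cvgV.
  by apply: cvgB; [apply: cvgB => //; exact: cvg2|exact: cvg2].
have cv : v @ (1 : R) --> v 1.
  apply: cvgN; apply: cvgM; last exact: cvgV.
  by apply: cvgM => //; exact: cvg_cst.
have ce : (fun s => expR (u s)) @ (1 : R) --> expR (u 1).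
  by apply: (cvg_comp _ _ cu); exact: continuous_expR.
have cc : (fun s => cos (v s)) @ (1 : R) --> cos (v 1).
  by apply: (cvg_comp _ _ cv); exact: continuous_cos.
have cs : (fun s => sin (v s)) @ (1 : R) --> sin (v 1).
  by apply: (cvg_comp _ _ cv); exact: continuous_sin.
have E s : inner_fun (s%:C%C * expi t) =
    Complex (expR (u s) * cos (v s)) (expR (u s) * sin (v s)).
  by rewrite ray_ReIm.
split.
  rewrite E (_ : (fun s => _) = fun s => expR (u s) * cos (v s)).
    exact: cvgM.
  by apply/funext => s; rewrite E.
rewrite E (_ : (fun s => _) = fun s => expR (u s) * sin (v s)).
  exact: cvgM.
by apply/funext => s; rewrite E.
Qed.

Lemma cabs_inner_expi t : cabs (@inner_fun R (expi t)) = 1.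
Proof.
rewrite cabs_inner /inner_re /= (_ : 1 - _ - _ = 0); last first.
  by have := cos2Dsin2 t; lra.
by rewrite mul0r oppr0 expR0.
Qed.

Lemma cos_neq1 (t : R) : 0 < t < 2 * pi -> cos t != 1.
Proof.
move=> /andP[t0 t1]; have -> : t = t / 2 + t / 2 by lra.
have s0 : 0 < sin (t / 2) by apply: sin_gt0_pi; apply/andP; split; lra.
apply/eqP; rewrite cosD -!expr2 => E; have := cos2Dsin2 (t / 2).
have : 0 < sin (t / 2) ^+ 2 by rewrite exprn_gt0.
lra.
Qed.

(** Away from [expi t = 1] the closed formulas are continuous up to the circle, so the limits are
    their values there and [S] has modulus 1. The exceptional set is the pair of endpoints [0] and
    [2 * pi]. *)
Lemma radial_limits_ae :
  {ae (@lebesgue_measure R), forall t : R, `[0, 2 * pi]%classic t ->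
    exists L1 L2 : R[i], radial_limit (@phi1 R) t L1 /\ radial_limit (@phi2 R) t L2 /\
                         cabs L1 = cabs L2}.
Proof.
exists [set 0; 2 * pi]; split.
- by apply: countable_measurable => [x|]; [exact: measurable_set1|exact/finite_set_countable/finite_set2].
- by apply: countable_lebesgue_measure0; exact/finite_set_countable/finite_set2.
move=> t /= h; apply: contrapT => tn; apply: h.
rewrite in_itv /= => /andP[t0 t1].
have tp : 0 < t < 2 * pi.
  rewrite !lt_neqAle t0 t1 !andbT; apply/andP; split; apply/eqP => E; apply: tn.
  - by left.
  - by right.
have c1 := cos_neq1 tp.
exists (phi1 (expi t)), (phi2 (expi t)); split; [|split].
- by apply: ccont_radial_limit; exact: ccont_phi1.
- apply: ccont_radial_limit; apply: ccontM; [exact: ccont_inner|exact: ccont_phi1].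
- by rewrite [RHS]cabsM cabs_inner_expi mul1r.
Qed.

End RadialLimits.

Unset Implicit Arguments.

Theorem mainTheorem3 (R : realType) :
  exists phi1 phi2 : R[i] -> R[i],
    analytic_selfmap phi1 /\ analytic_selfmap phi2 /\
    {ae (@lebesgue_measure R), forall t : R, `[0, 2 * pi]%classic t ->
        exists L1 L2 : R[i], radial_limit phi1 t L1 /\ radial_limit phi2 t L2 /\
                              cabs L1 = cabs L2} /\
    comp_maps_H2 phi1 /\ comp_maps_H2 phi2 /\
    comp_compact phi2 /\ ~ comp_compact phi1.
Proof.
exists (@phi1 R), (@phi2 R); split; first exact: phi1_analytic.
split; first exact: phi2_analytic.
split; first exact: radial_limits_ae.
split; first exact: phi1_maps.
split; first exact: phi2_maps.
by split; [exact: phi2_compact|exact: phi1_not_compact].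
Qed.
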